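(* Let $d\in\mathbb{N}$, $\Omega=\{1,2,\ldots,d\}^{\mathbb{N}}$, let $A:\Omega\to\mathbb{R}$ be a Hölder potential, and let $F(x)=\pm\beta x^2/2$ with $\beta>0$ (either choice of sign). Then, with the same sign throughout, $$-\inf_{\rho\in\mathcal{P}(T)}\mathfrak{f}^{\pm}(\rho)=-\inf_{\rho\in\mathcal{P}(T)}\mathfrak{g}^{\pm}(\rho)=\hat P(F).$$
   Context: $T:\Omega\to\Omega$ is the shift $T(x_1,x_2,\ldots)=(x_2,x_3,\ldots)$; $\Omega$ carries the metric $d(x,y)=2^{-\min\{n:\,x_n\neq y_n\}}$, and ''Hölder'' refers to this metric. $\mathcal{P}(T)$ is the set of $T$-invariant Borel probabilities on $\Omega$; $h(\rho)$ is the Kolmogorov-Sinai entropy; $\rho(A)=\int A\,\mathrm{d}\rho$; $\mu$ is the maximal entropy probability (product measure with uniform marginals). $A_n=\frac1n(A+A\circ T+\cdots+A\circ T^{n-1})$. Define for $\rho\in\mathcal{P}(T)$: $$\Delta_A(\rho)=\lim_{n\to\infty}\frac12\int A_n(x)^2\rho(\mathrm{d}x),$$ $$\mathfrak{f}^{\pm}(\rho)=-\left(\pm\beta\Delta_A(\rho)+h(\rho)-\log d\right),\qquad \mathfrak{g}^{\pm}(\rho)=-\left(\pm\frac{\beta}{2}\rho(A)^2+h(\rho)-\log d\right).$$ Moreover $\hat P(F)=\lim_{n\to\infty}\frac1n\log\int e^{nF(A_n(x))}\mu(\mathrm{d}x)$. *)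

(* Defs.v *)
From HB Require Import structures.
From mathcomp Require Import all_boot all_order all_algebra.
From mathcomp Require Import all_classical all_reals all_analysis.

Set Implicit Arguments.
Unset Strict Implicit.
Unset Printing Implicit Defensive.

Import Order.TTheory GRing.Theory Num.Theory.
Import numFieldNormedType.Exports.

Local Open Scope classical_set_scope.
Local Open Scope ring_scope.

(* Sequences over an alphabet of d.+1 letters: the offset builds in the
   requirement of at least one letter, which also makes the type pointed, as
   [measurableType] demands.  The parameter [R] is the field in which the metric
   below takes its values. *)
Definition fullshift (R : realType) (d : nat) : Type := nat -> 'I_d.+1.

HB.instance Definition _ (R : realType) (d : nat) :=
  gen_eqMixin (fullshift R d).
HB.instance Definition _ (R : realType) (d : nat) :=
  gen_choiceMixin (fullshift R d).
HB.instance Definition _ (R : realType) (d : nat) :=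
  isPointed.Build (fullshift R d) (fun=> ord0).

(* 2 ^ - min {n >= 1 : x_n <> y_n} for sequences indexed from 1; indices start
   at 0 here, whence the successor in the exponent. *)
Definition shift_dist (R : realType) (d : nat) (x y : fullshift R d) : R :=
  if pselect (exists n, x n != y n) is left xy
  then 2^-1 ^+ (ex_minn xy).+1 else 0.

Lemma shift_dist_ltP (R : realType) (d : nat) (x y : fullshift R d) (n : nat) :
  reflect (forall i, (i <= n)%N -> x i = y i)
          (shift_dist x y < 2^-1 ^+ n.+1).
Proof.
have half_gt0 k : 0 < 2^-1 ^+ k :> R by rewrite exprn_gt0 // invr_gt0.
have h0 : 0 < 2^-1 :> R by rewrite invr_gt0.
have h1 : 2^-1 < 1 :> R by rewrite invf_lt1 // ltr1n.
rewrite /shift_dist; case: pselect => [xy|nxy]; last first.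
  rewrite half_gt0; apply: ReflectT => i _; apply/eqP/negPn/negP => xyi.
  by apply: nxy; exists i.
rewrite ltr_iXn2l // ltnS; case: ex_minnP => m xym m_min.
apply: (iffP idP) => [nm i le_in|eq_xy].
  apply/eqP/negPn/negP => /m_min; apply/negP; rewrite -ltnNge.
  exact: leq_ltn_trans nm.
by rewrite ltnNge; apply/negP => /eq_xy/eqP; apply/negP.
Qed.

Lemma shift_distxx (R : realType) (d : nat) (x : fullshift R d) :
  shift_dist x x = 0.
Proof.
rewrite /shift_dist; case: pselect => // xx; exfalso.
by case: xx => n; rewrite eqxx.
Qed.

Lemma shift_dist_eq0 (R : realType) (d : nat) (x y : fullshift R d) :
  shift_dist x y = 0 -> x = y.
Proof.
move=> xy0; apply: funext => n.
have /shift_dist_ltP : shift_dist x y < 2^-1 ^+ n.+1.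
  by rewrite xy0 exprn_gt0 // invr_gt0.
exact.
Qed.

Lemma shift_dist_sym (R : realType) (d : nat) (x y : fullshift R d) :
  shift_dist x y = shift_dist y x.
Proof.
rewrite /shift_dist; case: pselect => [xy|nxy]; case: pselect => [yx|nyx] //.
- case: ex_minnP => m xym m_min; case: ex_minnP => k yxk k_min.
  suff -> : m = k by [].
  by apply/eqP; rewrite eqn_leq m_min 1?eq_sym // k_min // eq_sym.
- by case: nyx; case: xy => n xyn; exists n; rewrite eq_sym.
- by case: nxy; case: yx => n yxn; exists n; rewrite eq_sym.
Qed.

Lemma shift_dist_triangle (R : realType) (d : nat) (y x z : fullshift R d) :
  shift_dist x z <= shift_dist x y + shift_dist y z.
Proof.
have dist_ge0 (u v : fullshift R d) : 0 <= shift_dist u v.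
  by rewrite /shift_dist; case: pselect => // ?; rewrite exprn_ge0 // invr_ge0.
rewrite {1}/shift_dist; case: pselect => [xz|_]; last exact: addr_ge0.
case: ex_minnP => m xzm _; rewrite leNgt; apply/negP => lt_m.
have /shift_dist_ltP/(_ m (leqnn m)) xym : shift_dist x y < 2^-1 ^+ m.+1.
  by apply: le_lt_trans lt_m; rewrite lerDl.
have /shift_dist_ltP/(_ m (leqnn m)) yzm : shift_dist y z < 2^-1 ^+ m.+1.
  by apply: le_lt_trans lt_m; rewrite lerDr.
by move: xzm; rewrite xym yzm eqxx.
Qed.

HB.instance Definition _ (R : realType) (d : nat) :=
  @isMetric.Build R (fullshift R d) (@shift_dist R d) (@shift_distxx R d)
    (@shift_dist_eq0 R d) (@shift_dist_sym R d) (@shift_dist_triangle R d).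

Definition borel_fullshift (R : realType) (d : nat) :=
  g_sigma_algebraType (@open (fullshift R d)).

Definition shift_map (R : realType) (d : nat) (x : fullshift R d) :
  fullshift R d := fun n => x n.+1.

Definition hoelder_continuous (R : realType) (M : metricType R) (A : M -> R) : Prop :=
  exists C a : R, [/\ 0 <= C, 0 < a <= 1 &
    forall x y, `|A x - A y| <= C * mdist x y `^ a].

Definition birkhoff_mean (R : realType) (X : Type) (T : X -> X) (A : X -> R)
    (n : nat) (x : X) : R :=
  n%:R^-1 * \sum_(i < n) A (iter i T x).

Definition invariant_probabilities (R : realType) (dX : measure_display)
    (X : measurableType dX) (T : X -> X) : set (probability X R) :=
  [set rho : probability X R | forall B, measurable B -> rho (T @^-1` B) = rho B].

Definition finite_partition (dX : measure_display) (X : measurableType dX)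
    (k : nat) (P : 'I_k -> set X) : Prop :=
  [/\ forall a, measurable (P a), trivIset setT P & \bigcup_a P a = setT].

(* Shannon entropy of the join of P, T^-1 P, ..., T^-(n-1) P, whose cells are
   indexed by the words of length n; [ln 0 = 0] gives 0 log 0 = 0. *)
Definition join_entropy (R : realType) (dX : measure_display)
    (X : measurableType dX) (T : X -> X) (rho : probability X R)
    (k : nat) (P : 'I_k -> set X) (n : nat) : R :=
  - \sum_(w : {ffun 'I_n -> 'I_k})
      let p := fine (rho (\bigcap_(i : 'I_n) (iter i T @^-1` P (w i)))) in
      p * ln p.

Definition partition_entropy (R : realType) (dX : measure_display)
    (X : measurableType dX) (T : X -> X) (rho : probability X R)
    (k : nat) (P : 'I_k -> set X) : R :=
  limn (fun n => n%:R^-1 * join_entropy T rho P n).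

Definition ks_entropy (R : realType) (dX : measure_display)
    (X : measurableType dX) (T : X -> X) (rho : probability X R) : \bar R :=
  ereal_sup [set e | exists (k : nat) (P : 'I_k -> set X),
    finite_partition P /\ e = (partition_entropy T rho P)%:E].

(* [mu] is the product of the uniform laws on the alphabet; its values on
   rectangles determine it. *)
Definition uniform_product (R : realType) (d : nat)
    (mu : probability (borel_fullshift R d) R) : Prop :=
  forall (n : nat) (B : 'I_n -> {set 'I_d.+1}),
    mu [set x : fullshift R d | forall i : 'I_n, x i \in B i] =
    (\prod_(i < n) (#|B i|%:R / d.+1%:R))%:E.

Definition Delta (R : realType) (d : nat) (A : fullshift R d -> R)
    (rho : probability (borel_fullshift R d) R) : R :=
  limn (fun n => 2^-1 * \int[rho]_x (birkhoff_mean (@shift_map R d) A n x ^+ 2)).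

(* Below, the sign is + for [s = false] and - for [s = true]. *)
Definition quadratic (R : realType) (s : bool) (beta x : R) : R :=
  (-1) ^+ s * (beta * x ^+ 2 / 2).

Definition frakf (R : realType) (d : nat) (s : bool) (beta : R)
    (A : fullshift R d -> R) (rho : probability (borel_fullshift R d) R) :
    \bar R :=
  (- (((-1) ^+ s * (beta * Delta A rho))%:E
      + ks_entropy (X := borel_fullshift R d) (@shift_map R d) rho - (ln d.+1%:R)%:E))%E.

Definition frakg (R : realType) (d : nat) (s : bool) (beta : R)
    (A : fullshift R d -> R) (rho : probability (borel_fullshift R d) R) :
    \bar R :=
  (- (((-1) ^+ s * (beta / 2 * (\int[rho]_x A x) ^+ 2))%:E
      + ks_entropy (X := borel_fullshift R d) (@shift_map R d) rho - (ln d.+1%:R)%:E))%E.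

Definition pressure_seq (R : realType) (d : nat) (A : fullshift R d -> R)
    (mu : probability (borel_fullshift R d) R) (F : R -> R) (n : nat) : R :=
  n%:R^-1 *
  ln (\int[mu]_x expR (n%:R * F (birkhoff_mean (@shift_map R d) A n x))).

Definition pressure (R : realType) (d : nat) (A : fullshift R d -> R)
    (mu : probability (borel_fullshift R d) R) (F : R -> R) : R :=
  limn (pressure_seq A mu F).

(* Main.v *)
Require Import Defs.
From HB Require Import structures.
From mathcomp Require Import all_boot all_order all_algebra.
From mathcomp Require Import all_classical all_reals all_analysis.
From mathcomp Require Import measurable_realfun.
From mathcomp Require Import ring lra.

(** Let D be the number of letters, S_n the Birkhoff sums of A, A_n = S_n / n,
    F the quadratic function, p_n the n-th term of the pressure sequence, and
    Z_n the sum over all words w of length n of exp (n F (A_n x_w)), where x_w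
    is a point beginning with w.  Since A is Hoelder, S_n varies by at most a
    constant on the points sharing their first n letters, whatever n is; as mu
    gives mass D ^ - n to each word, p_n = log Z_n / n - log D + O (1 / n)
    ([pressure_seq_dist]).  Everything then becomes a finite counting problem
    about words.

    Let V (rho) be either of the two functionals -f and -g.  It suffices to
    show, for every e > 0,
      (i) for each invariant rho, p_n >= V (rho) - e for all large n;
      (ii) for all large n, some invariant rho has V (rho) >= p_n - e.
    Together they force p_n to converge to the supremum of V
    ([sup_envelope_cvg]), so the limit exists and both suprema equal it,
    for either sign.

    (i) for f is the finite Gibbs inequality
    H (q) + E_q (G) <= log (sum of exp G), applied to the law q of the first n
    letters under rho and to G = n F (A_n) ([pressure_seq_ge_moment]).
    For g one needs F at the mean of A rather than the mean of F (A_n), which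
    differ when rho is not ergodic.  So the Gibbs inequality is applied to
    words made of independent blocks of length N, each drawn with the law of
    rho: they have the entropy of N-blocks of rho, and by a variance
    computation their A_n concentrates around the mean of A
    ([pressure_seq_ge_mean]).

    (ii) Sort the words of length n by the value of A_n into boundedly many
    narrow bins; some bin W carries Z_n up to a bounded factor
    ([pigeonhole_sum]), so that log Z_n is close to log #|W| + n F (a), where
    a is the value of A_n on W.  Choose j with D ^ j <= #|W| and
    log #|W| <= (j + 1) log D, and encode words of length j injectively by elements of W.  Applying this code
    block by block to a mu-distributed sequence, and averaging over the n
    possible phases, gives an invariant probability
    ([exists_block_code_probability]).  Its entropy is at least j log D / n.
    All its orbits are concatenations of elements of W, so its Birkhoff means
    are uniformly close to a, which controls the mean of A and the limit of
    the second moments of A_n at once ([exists_probability_of_words]).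

    The Kolmogorov-Sinai entropy is a supremum over all Borel partitions.  It
    is attained at the partition by the first letter, because Borel sets are
    approximated by sets depending on finitely many letters
    ([measurable_approximable]) and because a finite code that is wrong with
    small probability costs little entropy per step
    ([entropy_rate_le_approx]). *)

Set Implicit Arguments.
Unset Strict Implicit.
Unset Printing Implicit Defensive.

Import Order.TTheory GRing.Theory Num.Theory.
Import numFieldNormedType.Exports.

Local Open Scope classical_set_scope.
Local Open Scope ring_scope.

(** * Convergence of sequences and finite sums *)

Lemma ln_le_subr1 (R : realType) (x : R) : 0 < x -> ln x <= x - 1.
Proof.
move=> x0; have -> : ln x = ln (1 + (x - 1)) by rewrite addrC subrK.
by apply: le_ln1Dx; lra.
Qed.

Lemma cvg_idn_inv0 (R : realType) : (n%:R : R)^-1 @[n --> \oo] --> (0 : R).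
Proof. by rewrite -cvg_shiftS; exact: cvg_harmonic. Qed.

(** The two hypotheses bound liminf p below by sup S and limsup p above by it. *)
Lemma sup_envelope_cvg (R : realType) (S : set R) (p : R^nat) (M : R) :
  (forall n, p n <= M) ->
  (forall v, S v -> forall e, 0 < e -> \forall n \near \oo, v - e <= p n) ->
  (forall e, 0 < e -> \forall n \near \oo, exists2 v, S v & p n - e <= v) ->
  has_sup S /\ p n @[n --> \oo] --> sup S.
Proof.
move=> pM lo up.
have supS : has_sup S.
  split.
    have [N _ /(_ N (leqnn N)) [v Sv _]] := up 1 ltr01; by exists v.
  exists (M + 1) => v Sv.
  have [N _ /(_ N (leqnn N))] := lo v Sv 1 ltr01.
  by have := pM N; lra.
split=> //; apply/cvgrPdist_le => e e0.
have [v Sv vlt] := sup_adherent (divr_gt0 e0 (ltr0n _ 2)) supS.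
have e2 : 0 < e / 2 by rewrite divr_gt0.
near=> n.
have h1 : v - e / 2 <= p n by near: n; exact: lo.
have [w Sw h2] : exists2 w, S w & p n - e / 2 <= w by near: n; exact: up.
have h3 : w <= sup S by apply: ub_le_sup => //; exact: supS.2.
rewrite ler_norml; apply/andP; split; lra.
Unshelve. all: by end_near. Qed.

(** This is [sup_envelope_cvg] for p n = - u n / n and S the set of all values
    - u m / m with m > 0: Euclidean division of n by m gives the lower bound, and
    each p n is itself in S. *)
Lemma fekete (R : realType) (u : R^nat) :
  (forall n, 0 <= u n) -> (forall m n, u (m + n)%N <= u m + u n) ->
  cvgn (fun n => n%:R^-1 * u n) /\
  forall n, (0 < n)%N -> limn (fun n => n%:R^-1 * u n) <= n%:R^-1 * u n.
Proof.
move=> u0 uD.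
have uM m q : u (q * m)%N <= u 0%N + q%:R * u m.
  elim: q => [|q IH]; first by rewrite mul0n mul0r addr0.
  by rewrite mulSn; apply: le_trans (uD _ _) _; rewrite -natr1 mulrDl mul1r; lra.
pose S := [set v | exists2 m, (0 < m)%N & v = - (m%:R^-1 * u m)].
have [] := @sup_envelope_cvg R S (fun n => - (n%:R^-1 * u n)) 0.
- by move=> n; rewrite oppr_le0 mulr_ge0.
- move=> v [m m0 ->] e e0.
  pose B := u 0%N + \sum_(r < m) u r.
  have B0 : 0 <= B by rewrite addr_ge0 // sumr_ge0.
  exists (Num.truncn (B / e)).+1 => // n /= nB.
  have n0 : (0 < n)%N by exact: leq_ltn_trans nB.
  have nR : 0 < n%:R :> R by rewrite ltr0n.
  have mR : 0 < m%:R :> R by rewrite ltr0n.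
  have Bn : B <= e * n%:R.
    rewrite mulrC -ler_pdivrMr //; apply/ltW; apply: lt_le_trans (truncnS_gt _) _.
    by rewrite ler_nat.
  have h : u n <= (n %/ m)%N%:R * u m + B.
    rewrite {1}(divn_eq n m); apply: le_trans (uD _ _) _.
    have := uM m (n %/ m)%N.
    have : u (n %% m)%N <= \sum_(r < m) u r.
      rewrite (bigD1 (Ordinal (ltn_pmod n m0))) //= lerDl sumr_ge0 //.
    by rewrite /B; lra.
  have h2 : (n %/ m)%N%:R <= n%:R / m%:R :> R.
    by rewrite ler_pdivlMr // -natrM ler_nat leq_divM.
  rewrite -opprD lerN2 ler_pdivrMl //.
  apply: le_trans h _; rewrite mulrDr; apply: lerD; last by rewrite mulrC.
  by rewrite mulrA ler_wpM2r.
- move=> e e0; exists 1%N => // n /= n0; exists (- (n%:R^-1 * u n)); last by lra.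
  by exists n.
move=> supS cv.
have {}cv : n%:R^-1 * u n @[n --> \oo] --> - sup S.
  by rewrite (_ : (fun _ => _) = - (fun n => - (n%:R^-1 * u n)));
    [exact: cvgN|apply/funext => n /=; rewrite fctE opprK].
split; first by apply/cvg_ex; eexists; exact: cv.
move=> n n0; rewrite (cvg_lim _ cv) // lerNl; apply: ub_le_sup; first exact: supS.2.
by exists n.
Qed.

Lemma near_inv_le (R : realType) (c e : R) : 0 < e ->
  \forall n \near \oo, n%:R^-1 * c <= e.
Proof.
move=> e0; have cv : (fun n => n%:R^-1 * c) @ \oo --> (0 : R).
  by rewrite -[X in _ --> X](mul0r c); apply: cvgMr_tmp; exact: cvg_idn_inv0.
exact: (cvgr_le _ cv).
Qed.

(** The exponent j is the integer part of log m / log (d + 1), except that the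
    logarithm vanishes for d = 0, where the bound on m leaves only m = 1. *)
Lemma exists_power_below (R : realType) (d n m : nat) : (0 < m)%N -> (m <= d.+1 ^ n)%N ->
  exists2 j, (d.+1 ^ j <= m)%N & ln m%:R <= j.+1%:R * ln d.+1%:R :> R.
Proof.
move=> m0 mn; have [d0|d0] := posnP d.
  exists 0%N; first by rewrite expn0.
  have -> : m = 1%N by apply/eqP; rewrite eqn_leq m0 andbT; move: mn; rewrite d0 exp1n.
  by rewrite d0 ln1 mulr0.
exists (trunc_log d.+1 m); first by apply: trunc_logP.
rewrite mulr_natl -lnXn ?ltr0n // ler_ln ?posrE ?ltr0n ?exprn_gt0 //.
by rewrite -natrX ler_nat ltnW // trunc_log_ltn.
Qed.

Lemma ln_prod (R : realType) (I : finType) (F : I -> R) :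
  (forall i, 0 < F i) -> ln (\prod_i F i) = \sum_i ln (F i).
Proof.
move=> F0; suff [] : 0 < \prod_i F i /\ ln (\prod_i F i) = \sum_i ln (F i) by [].
elim/big_ind2 : _ => [|x y x' y' [x0 <-] [x'0 <-]|i _]; first by rewrite ln1.
  by rewrite mulr_gt0 // lnM.
by split.
Qed.

Lemma pigeonhole_sum (R : realType) (I : finType) (B : nat) (c : I -> 'I_B) (G : I -> R) :
  (0 < B)%N -> exists b, \sum_i G i <= B%:R * \sum_(i | c i == b) G i.
Proof.
move=> B0; apply: contrapT => nex.
have lt b : \sum_(i | c i == b) G i < B%:R^-1 * \sum_i G i.
  rewrite ltNge; apply/negP => h; apply: nex; exists b.
  by rewrite -ler_pdivrMl ?ltr0n.
have : \sum_i G i < \sum_(b < B) B%:R^-1 * \sum_i G i.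
  rewrite [X in X < _](partition_big c xpredT) //=; apply: ltr_sum => [|b _].
    by apply/hasP; exists (Ordinal B0); rewrite ?mem_index_enum.
  exact: lt.
rewrite sumr_const card_ord -[_ *+ B]mulr_natl mulrA divff ?mul1r ?ltxx //.
by rewrite pnatr_eq0 -lt0n.
Qed.

(** * Entropy of finite distributions *)

Section finite_entropy.
Context {R : realType} {J : finType}.
Implicit Types (p q G : J -> R).

Definition shannon p : R := - \sum_j p j * ln (p j).

(** Comes from log x <= x - 1 at x = q j / p j.  The positivity hypothesis is
    absolute continuity: with ln 0 = 0 the bound fails without it. *)
Lemma gibbs p q : (forall j, 0 <= p j) -> (forall j, 0 <= q j) ->
  \sum_j q j <= \sum_j p j -> (forall j, 0 < p j -> 0 < q j) ->
  shannon p <= - \sum_j p j * ln (q j).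
Proof.
move=> p0 q0 qp pq; rewrite lerN2 -subr_le0 -sumrB.
apply: (@le_trans _ _ (\sum_j (q j - p j))); last by rewrite sumrB subr_le0.
apply: ler_sum => j _; have [pj|pj] := ltrP 0 (p j); last first.
  have -> : p j = 0 by apply/eqP; rewrite eq_le pj p0.
  by rewrite !mul0r !subr0.
have qj := pq j pj.
rewrite -mulrBr -ln_div ?posrE//.
apply: le_trans (ler_wpM2l (p0 j) (ln_le_subr1 (divr_gt0 qj pj))) _.
by rewrite mulrBr mulr1 mulrCA divff ?mulr1 // gt_eqF.
Qed.

(** Gibbs' inequality against the distribution proportional to exp G: the finite
    form of the variational principle for pressure. *)
Lemma gibbs_variational p G : (forall j, 0 <= p j) -> \sum_j p j = 1 ->
  shannon p + \sum_j p j * G j <= ln (\sum_j expR (G j)).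
Proof.
move=> p0 p1; set Z := \sum_j expR (G j).
have Z0 : 0 < Z.
  have [j _] : exists j : J, true.
    apply/existsP; apply: contraT => /existsPn J0; exfalso.
    by have := p1; rewrite big1 => [/eqP|j _]; [rewrite eq_sym oner_eq0|have := J0 j].
  rewrite /Z (bigD1 j) //= ltr_wpDr ?expR_gt0// sumr_ge0 // => i _; exact: expR_ge0.
have := @gibbs p (fun j => expR (G j) / Z) p0.
have q0 j : 0 < expR (G j) / Z by rewrite divr_gt0 ?expR_gt0.
move=> /(_ (fun j => ltW (q0 j))); rewrite -mulr_suml -/Z divff ?gt_eqF// p1.
move=> /(_ (lexx _) (fun j _ => q0 j)).
under eq_bigr do rewrite ln_div ?posrE ?expR_gt0// expRK mulrBr.
by rewrite sumrB -mulr_suml p1 mul1r; lra.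
Qed.

Lemma shannon_ge0 p : (forall j, 0 <= p j <= 1) -> 0 <= shannon p.
Proof.
move=> p01; rewrite oppr_ge0; apply: sumr_le0 => j _.
by have /andP[? ?] := p01 j; rewrite mulr_ge0_le0 // ln_le0.
Qed.

Lemma shannon_ge p (c : R) : (forall j, 0 <= p j <= c) -> \sum_j p j = 1 ->
  - ln c <= shannon p.
Proof.
move=> pc p1; rewrite lerN2 -[leRHS]mul1r -p1 mulr_suml; apply: ler_sum => j _.
have /andP[p0 pjc] := pc j; have [pj|pj] := ltrP 0 (p j); last first.
  have -> : p j = 0 by apply/eqP; rewrite eq_le pj p0.
  by rewrite !mul0r.
by rewrite ler_wpM2l // ler_ln ?posrE //; exact: lt_le_trans pjc.
Qed.

End finite_entropy.

Lemma convex_sum_le (R : realType) (J : finType) (p G : J -> R) (c : R) :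
  (forall j, 0 <= p j) -> \sum_j p j = 1 -> (forall j, G j <= c) ->
  \sum_j p j * G j <= c.
Proof.
move=> p0 p1 Gc; rewrite (_ : c = \sum_j p j * c); last by rewrite -mulr_suml p1 mul1r.
by apply: ler_sum => j _; rewrite ler_wpM2l.
Qed.

Section product_distribution.
Context {R : realType} {J : finType} (p : J -> R) (M : nat).
Hypothesis p0 : forall j, 0 <= p j.
Hypothesis p1 : \sum_j p j = 1.

Definition prod_dist (f : {ffun 'I_M -> J}) : R := \prod_i p (f i).

Lemma prod_dist_ge0 f : 0 <= prod_dist f.
Proof. by apply: prodr_ge0. Qed.

Lemma prod_dist_expectation2 (i j : 'I_M) (g h : J -> R) : i != j ->
  \sum_f prod_dist f * (g (f i) * h (f j)) =
  (\sum_a p a * g a) * (\sum_a p a * h a).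
Proof.
move=> ij; have ji : (j == i) = false by rewrite eq_sym (negbTE ij).
pose G k a := p a * (if k == i then g a else if k == j then h a else 1).
have E f : prod_dist f * (g (f i) * h (f j)) = \prod_k G k (f k).
  rewrite /G big_split /=; congr (_ * _).
  rewrite (bigD1 i) //= eqxx; congr (_ * _).
  rewrite (bigD1 j) ?ji //= ?ji eqxx big1 ?mulr1 // => k /andP[ki kj].
  by rewrite (negbTE ki) (negbTE kj).
under eq_bigr do rewrite E.
rewrite -(bigA_distr_bigA G) (bigD1 i) //= (bigD1 j) ?ji //= [X in _ * (_ * X)]big1 ?mulr1.
  by rewrite /G ji !eqxx.
by move=> k /andP[ki kj]; rewrite /G (negbTE ki) (negbTE kj); under eq_bigr do rewrite mulr1.
Qed.

Lemma prod_dist_expectation (i : 'I_M) (g : J -> R) :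
  \sum_f prod_dist f * g (f i) = \sum_a p a * g a.
Proof.
pose G k a := p a * (if k == i then g a else 1).
have E f : prod_dist f * g (f i) = \prod_k G k (f k).
  rewrite /G big_split /=; congr (_ * _).
  rewrite (bigD1 i) //= eqxx big1 ?mulr1 // => k ki.
  by rewrite (negbTE ki).
under eq_bigr do rewrite E.
rewrite -(bigA_distr_bigA G) (bigD1 i) //= [X in _ * X]big1 ?mulr1.
  by rewrite /G eqxx.
by move=> k ki; rewrite /G (negbTE ki); under eq_bigr do rewrite mulr1.
Qed.

Lemma prod_dist_sum1 : \sum_f prod_dist f = 1.
Proof.
by rewrite -(bigA_distr_bigA (fun _ a => p a)) p1 big1_eq.
Qed.

Lemma prod_dist_expectation_sum (g : J -> R) :
  \sum_f prod_dist f * (\sum_i g (f i)) = M%:R * \sum_a p a * g a.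
Proof.
under eq_bigr do rewrite mulr_sumr.
rewrite exchange_big /=; under eq_bigr do rewrite prod_dist_expectation.
by rewrite sumr_const card_ord mulr_natl.
Qed.

(** For a centred g the off-diagonal terms vanish by independence, which leaves M
    times the variance of one draw. *)
Lemma prod_dist_variance (g : J -> R) : \sum_a p a * g a = 0 ->
  \sum_f prod_dist f * (\sum_i g (f i)) ^+ 2 = M%:R * \sum_a p a * g a ^+ 2.
Proof.
move=> g0.
have E f : prod_dist f * (\sum_i g (f i)) ^+ 2 =
    \sum_i \sum_j prod_dist f * (g (f i) * g (f j)).
  rewrite expr2 mulr_suml mulr_sumr; apply: eq_bigr => i _.
  by rewrite !mulr_sumr.
under eq_bigr do rewrite E.
rewrite exchange_big /= -[M in M%:R]card_ord -sum1_card natr_sum mulr_suml.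
apply: eq_bigr => i _; rewrite mul1r exchange_big /= (bigD1 i) //=.
rewrite [X in _ + X]big1 ?addr0 => [|j ji]; last first.
  by rewrite prod_dist_expectation2 1?eq_sym // g0 mul0r.
by rewrite (prod_dist_expectation i (fun a => g a * g a)).
Qed.

Lemma shannon_prod_dist : shannon prod_dist = M%:R * shannon p.
Proof.
rewrite /shannon mulrN -prod_dist_expectation_sum; congr (- _).
apply: eq_bigr => f _; have [f0|f0] := eqVneq (prod_dist f) 0; first by rewrite f0 !mul0r.
congr (_ * _); apply: ln_prod => i; rewrite lt0r p0 andbT.
by move: f0; apply: contra_neq => fi; rewrite /prod_dist (bigD1 i) //= fi mul0r.
Qed.

End product_distribution.

(** * Quadratic functions of a bounded variable *)

Section quadratic.
Context {R : realType} (s : bool) (beta : R).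
Hypothesis beta_ge0 : 0 <= beta.
Local Notation F := (quadratic s beta).

Lemma quadratic_dist (K x y : R) : `|x| <= K -> `|y| <= K ->
  `|F x - F y| <= beta * K * `|x - y|.
Proof.
move=> xK yK; rewrite /quadratic -mulrBr normrM normrX normrN1 expr1n mul1r.
have -> : beta * x ^+ 2 / 2 - beta * y ^+ 2 / 2 = beta / 2 * (x + y) * (x - y).
  by field.
rewrite !normrM (ger0_norm beta_ge0) normfV (ger0_norm (ler0n R 2)).
rewrite ler_wpM2r // -mulrA ler_wpM2l // ler_pdivrMl //.
by have := ler_normD x y; lra.
Qed.

Lemma quadratic_le (K x : R) : `|x| <= K -> `|F x| <= beta * K * K.
Proof.
move=> xK; have K0 : 0 <= K by exact: le_trans xK.
have h0 : `|0 : R| <= K by rewrite normr0.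
have := quadratic_dist xK h0.
rewrite {2}/quadratic expr0n /= mulr0 mul0r mulr0 !subr0 => h.
by apply: le_trans h _; rewrite ler_wpM2l // mulr_ge0.
Qed.

(** Taylor expansion of F at the mean: the linear term integrates to 0, so the
    error is half of beta times the variance, with the sign of F. *)
Lemma quadratic_expectation {I : finType} (q : I -> R) (Z : I -> R) (m : R) :
  (\sum_i q i = 1) -> \sum_i q i * Z i = m ->
  \sum_i q i * F (Z i) = F m + (-1) ^+ s * (beta / 2) * \sum_i q i * (Z i - m) ^+ 2.
Proof.
move=> q1 qm.
have -> : \sum_i q i * (Z i - m) ^+ 2 = \sum_i q i * Z i ^+ 2 - m ^+ 2.
  transitivity (\sum_i (q i * Z i ^+ 2 - (q i * Z i) * (2 * m) + q i * m ^+ 2)).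
    by apply: eq_bigr => i _; ring.
  by rewrite big_split sumrB /= -!mulr_suml qm q1; ring.
rewrite mulrBr /quadratic.
have -> : \sum_i q i * ((-1) ^+ s * (beta * Z i ^+ 2 / 2)) =
   (-1) ^+ s * (beta / 2) * \sum_i q i * Z i ^+ 2.
  by rewrite mulr_sumr; apply: eq_bigr => i _; field.
by field.
Qed.

End quadratic.

(** * Finite-valued observables and their laws *)

Section finite_valued.
Context {dX : measure_display} {X : measurableType dX}.

Definition finite_valued {J : finType} (c : X -> J) : Prop :=
  forall j, measurable (c @^-1` [set j]).

Lemma finite_valued_pred {J : finType} (c : X -> J) (P : pred J) :
  finite_valued c -> measurable [set x | P (c x)].
Proof.
move=> mc; have -> : [set x | P (c x)] = \bigcup_(j in [set j | P j]) (c @^-1` [set j]).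
  by apply/seteqP; split=> [x Px|x [j Pj /= ->]] //; exists (c x).
by apply: fin_bigcup_measurable => // j _.
Qed.

Lemma finite_valued_comp {J K : finType} (g : J -> K) (c : X -> J) :
  finite_valued c -> finite_valued (g \o c).
Proof.
move=> mc k; have := finite_valued_pred (fun j => g j == k) mc.
by congr (measurable _); apply/seteqP; split=> x /= /eqP.
Qed.

Lemma finite_valued_pair {J K : finType} (c : X -> J) (c' : X -> K) :
  finite_valued c -> finite_valued c' -> finite_valued (fun x => (c x, c' x)).
Proof.
move=> mc mc' [j k]; have := measurableI _ _ (mc j) (mc' k).
by congr (measurable _); apply/seteqP; split=> x /= [-> ->].
Qed.

Lemma finite_valued_ffun {I J : finType} (c : I -> X -> J) :
  (forall i, finite_valued (c i)) -> finite_valued (fun x => [ffun i => c i x]).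
Proof.
move=> mc w.
have : measurable (\bigcap_(i in [set: I]) (c i @^-1` [set w i])).
  by apply: fin_bigcap_measurable => [|i _]; [exact: finite_finset|exact: mc].
congr (measurable _); apply/seteqP; split=> x /=.
  by move=> cw; apply/ffunP => i; rewrite ffunE; exact: cw.
by move=> <- i _ /=; rewrite ffunE.
Qed.

Lemma finite_valued_measurable {J : finType} (c : X -> J) (T : X -> X) :
  measurable_fun setT T -> finite_valued c -> finite_valued (c \o T).
Proof.
move=> mT mc j; have := mT measurableT _ (mc j).
by rewrite setTI.
Qed.

Section law.
Context {R : realType} (rho : probability X R).

Definition law {J : finType} (c : X -> J) (j : J) : R :=
  fine (rho (c @^-1` [set j])).

Lemma law_ge0 {J : finType} (c : X -> J) j : 0 <= law c j.
Proof. exact: fine_ge0. Qed.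

Lemma fine_probability E : measurable E -> (fine (rho E))%:E = rho E.
Proof. by move=> mE; rewrite fineK // fin_num_measure. Qed.

Lemma fine_probability_le A B : measurable A -> measurable B -> A `<=` B ->
  fine (rho A) <= fine (rho B).
Proof.
by move=> mA mB AB; rewrite fine_le ?fin_num_measure // le_measure ?inE.
Qed.

Lemma finite_union_bound {J : finType} (E : set X) (F : J -> set X) :
  measurable E -> (forall a, measurable (F a)) ->
  (forall x, E x -> exists a, F a x) ->
  fine (rho E) <= \sum_a fine (rho (F a)).
Proof.
move=> mE mF EF; pose G s := \big[setU/set0]_(a <- s) F a.
have mG s : measurable (G s) by apply: bigsetU_measurable => a _.
apply: (@le_trans _ _ (fine (rho (G (index_enum J))))).
  apply: fine_probability_le => // x /EF[a Fa].
  by rewrite /G -bigcup_seq; exists a => //=; rewrite mem_index_enum.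
elim: (index_enum J) => [|a s IH]; first by rewrite /G !big_nil measure0.
rewrite big_cons; apply: le_trans (lerD (lexx _) IH).
rewrite /G big_cons -/(G s) -fineD ?fin_num_measure //.
rewrite fine_le ?fin_numD ?fin_num_measure //; first exact: measurableU.
by apply: measureU2.
Qed.

Lemma law_pred {J : finType} (c : X -> J) (P : pred J) : finite_valued c ->
  fine (rho [set x | P (c x)]) = \sum_(j | P j) law c j.
Proof.
move=> mc.
have -> : [set x | P (c x)] = \bigcup_(j in [set` P]) (c @^-1` [set j]).
  by apply/seteqP; split=> [x Px|x [j Pj /= ->]] //; exists (c x).
rewrite measure_fin_bigcup //; last first.
  by move=> i j _ _ [x [/= <- <-]].
rewrite -(@bigfs _ _ _ J (index_enum J) P) ?index_enum_uniq //; last first.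
  by move=> j _; rewrite mem_index_enum.
by rewrite -sum_fine // => j _; rewrite fin_num_measure.
Qed.

Lemma law_sum1 {J : finType} (c : X -> J) : finite_valued c ->
  \sum_j law c j = 1.
Proof.
move=> mc; have := @law_pred J c predT mc => <-.
rewrite (_ : [set _ | _] = setT) ?probability_setT //.
by apply/seteqP; split.
Qed.

Lemma law_le1 {J : finType} (c : X -> J) j : finite_valued c -> law c j <= 1.
Proof.
by move=> mc; rewrite -(law_sum1 mc) (bigD1 j) //= lerDl sumr_ge0 // => *; exact: law_ge0.
Qed.

Lemma law_comp {J K : finType} (g : J -> K) (c : X -> J) (k : K) :
  finite_valued c -> law (g \o c) k = \sum_(j | g j == k) law c j.
Proof.
move=> mc; rewrite -law_pred //; congr (fine (rho _)).
by apply/seteqP; split=> x /= /eqP.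
Qed.

Lemma law_expectation_comp {J K : finType} (g : J -> K) (c : X -> J) (G : K -> R) :
  finite_valued c ->
  \sum_k law (g \o c) k * G k = \sum_j law c j * G (g j).
Proof.
move=> mc; rewrite [RHS](partition_big g xpredT) //=; apply: eq_bigr => k _.
rewrite law_comp // mulr_suml; apply: eq_bigr => j /eqP <- //.
Qed.

Lemma Rintegral_finite_valued {J : finType} (c : X -> J) (G : J -> R) :
  finite_valued c -> \int[rho]_x G (c x) = \sum_j law c j * G j.
Proof.
move=> mc; have E x : (G (c x))%:E =
    (\sum_(j <- index_enum J) (G j)%:E * (\1_(c @^-1` [set j]) x)%:E)%E.
  rewrite (bigD1 (c x)) //= big1 ?adde0; last first.
    move=> j jc; rewrite indicE memNset ?mule0 //= => cx.
    by rewrite cx eqxx in jc.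
  by rewrite indicE mem_set //= mule1.
rewrite /Rintegral.
under eq_integral do rewrite E.
rewrite integral_sum //; last first.
  by move=> j; apply: integrableZl => //; apply: integrable_indic.
rewrite -sum_fine; last first.
  move=> j _; rewrite integralZl //; last exact: integrable_indic.
  by rewrite integral_indic // setIT fin_numM // fin_num_measure.
apply: eq_bigr => j _; rewrite integralZl //; last exact: integrable_indic.
by rewrite integral_indic // setIT fineM ?fin_num_measure //= mulrC.
Qed.

(** Merging values loses information: the law of g o c at g j dominates the law of
    c at j. *)
Lemma shannon_law_comp {J K : finType} (g : J -> K) (c : X -> J) :
  finite_valued c -> shannon (law (g \o c)) <= shannon (law c).
Proof.
move=> mc; rewrite lerN2 law_expectation_comp //; apply: ler_sum => j _.
have [pj|pj] := ltrP 0 (law c j); last first.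
  have -> : law c j = 0 by apply/eqP; rewrite eq_le pj law_ge0.
  by rewrite !mul0r.
rewrite ler_wpM2l ?law_ge0 // ler_ln ?posrE //.
  by rewrite law_comp // (bigD1 j) //= lerDl sumr_ge0 // => *; exact: law_ge0.
rewrite law_comp // (bigD1 j) //= ltr_wpDr // sumr_ge0 // => *; exact: law_ge0.
Qed.

(** Chain rule as an inequality: r is a guess for the conditional law of c given
    c', and a wrong guess only increases the last term.  It is Gibbs' inequality
    for the reference weights law c' k * r j k. *)
Lemma shannon_law_pair_le_conditional {J K : finType} (c : X -> J) (c' : X -> K)
    (r : J -> K -> R) : finite_valued c -> finite_valued c' ->
  (forall j k, 0 <= r j k) -> (forall k, \sum_j r j k <= 1) ->
  (forall j k, 0 < law (fun x => (c x, c' x)) (j, k) -> 0 < r j k) ->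
  shannon (law (fun x => (c x, c' x))) <= shannon (law c')
    - \sum_jk law (fun x => (c x, c' x)) jk * ln (r jk.1 jk.2).
Proof.
move=> mc mc' r0 r1 rpos.
have m2 := finite_valued_pair mc mc'; set c2 := fun x => (c x, c' x).
have pos jk : 0 < law c2 jk -> 0 < law c' jk.2.
  move=> h; rewrite -[c']/(snd \o c2) law_comp // (bigD1 jk) //= ltr_wpDr //.
  by rewrite sumr_ge0 // => *; exact: law_ge0.
apply: (@le_trans _ _
  (- \sum_jk law c2 jk * ln (law c' jk.2 * r jk.1 jk.2))).
  apply: gibbs => [jk|jk||[j k] h]; first exact: law_ge0.
  - by rewrite mulr_ge0 ?law_ge0.
  - rewrite law_sum1 // -(pair_bigA _ (fun j k => law c' k * r j k)) /= exchange_big /=.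
    rewrite -(law_sum1 mc'); apply: ler_sum => k _.
    by rewrite -mulr_sumr ler_piMr // law_ge0.
  - by rewrite mulr_gt0 ?rpos // (pos _ h).
have -> : shannon (law c') = - \sum_jk law c2 jk * ln (law c' jk.2).
  by rewrite -(law_expectation_comp snd (fun k => ln (law c' k)) m2).
rewrite -opprD lerN2 -big_split /=.
apply: ler_sum => -[j k] _.
have [pj|pj] := ltrP 0 (law c2 (j, k)); last first.
  have -> : law c2 (j, k) = 0 by apply/eqP; rewrite eq_le pj law_ge0.
  by rewrite !mul0r addr0.
by rewrite lnM ?posrE ?rpos ?(pos _ pj) // mulrDr.
Qed.

(** The guess that ignores c' gives subadditivity. *)
Lemma shannon_law_pair {J K : finType} (c : X -> J) (c' : X -> K) :
  finite_valued c -> finite_valued c' ->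
  shannon (law (fun x => (c x, c' x))) <= shannon (law c) + shannon (law c').
Proof.
move=> mc mc'; have m2 := finite_valued_pair mc mc'.
have := @shannon_law_pair_le_conditional _ _ c c' (fun j _ => law c j) mc mc'.
move=> /(_ (fun j _ => law_ge0 c j)); rewrite law_sum1 // => /(_ (fun=> lexx _)).
have -> : shannon (law c) =
    - \sum_jk law (fun x => (c x, c' x)) jk * ln (law c jk.1).
  by rewrite -(law_expectation_comp fst (fun k => ln (law c k)) m2).
rewrite addrC; apply => j k h.
rewrite -[c]/(fst \o (fun x => (c x, c' x))) law_comp // (bigD1 (j, k)) //= ltr_wpDr //.
by rewrite sumr_ge0 // => *; exact: law_ge0.
Qed.

End law.
End finite_valued.

(** * Entropy rates of an invariant probability *)

Section invariant.
Context {dX : measure_display} {X : measurableType dX} {R : realType}.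
Context {T : X -> X} {rho : probability X R}.
Hypothesis mT : measurable_fun setT T.
Hypothesis rhoT : invariant_probabilities T rho.

Definition itinerary {J : finType} (lab : X -> J) (n : nat) (x : X) :
  {ffun 'I_n -> J} := [ffun i : 'I_n => lab (iter i T x)].

Definition block_entropy {J : finType} (lab : X -> J) (n : nat) : R :=
  shannon (law rho (itinerary lab n)).

Definition entropy_rate {J : finType} (lab : X -> J) : R :=
  limn (fun n => n%:R^-1 * block_entropy lab n).

Lemma measurable_iter i : measurable_fun setT (iter i T).
Proof.
elim: i => [|i IH]; first exact: measurable_id.
by rewrite (_ : iter i.+1 T = T \o iter i T); [exact: measurableT_comp|apply/funext].
Qed.

Lemma invariant_iter i B : measurable B -> rho (iter i T @^-1` B) = rho B.
Proof.
elim: i B => [|i IH] B mB; first by [].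
rewrite -[RHS](rhoT mB) -[RHS]IH; last by rewrite -[_ @^-1` _]setTI; exact: mT.
by congr (rho _).
Qed.

Lemma law_iter {J : finType} (c : X -> J) i : finite_valued c ->
  law rho (c \o iter i T) = law rho c.
Proof.
move=> mc; apply/funext => j; rewrite /law comp_preimage invariant_iter //.
Qed.

Lemma finite_valued_itinerary {J : finType} (lab : X -> J) n :
  finite_valued lab -> finite_valued (itinerary lab n).
Proof.
move=> mlab; apply: finite_valued_ffun => i.
exact: (finite_valued_measurable (measurable_iter i) mlab).
Qed.

Lemma block_entropy_ge0 {J : finType} (lab : X -> J) n :
  finite_valued lab -> 0 <= block_entropy lab n.
Proof.
move=> mlab; apply: shannon_ge0 => w; rewrite law_ge0 law_le1 //.
exact: finite_valued_itinerary.
Qed.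

(** The itinerary of length m + n is a function of the pair of the first m labels
    and of the n labels after time m, which have the law of the first n labels by
    invariance. *)
Lemma block_entropyD {J : finType} (lab : X -> J) m n : finite_valued lab ->
  block_entropy lab (m + n) <= block_entropy lab m + block_entropy lab n.
Proof.
move=> mlab; have mI k := finite_valued_itinerary (n := k) mlab.
have mIm := finite_valued_measurable (measurable_iter m) (mI n).
have -> : block_entropy lab n = shannon (law rho (itinerary lab n \o iter m T)).
  by rewrite law_iter.
apply: le_trans (shannon_law_pair _ (mI m) mIm).
pose g (uv : {ffun 'I_m -> J} * {ffun 'I_n -> J}) : {ffun 'I_(m + n) -> J} :=
  [ffun i => match fintype.split i with inl j => uv.1 j | inr j => uv.2 j end].
rewrite /block_entropy.
have -> : itinerary lab (m + n) = g \o (fun x => (itinerary lab m x, (itinerary lab n \o iter m T) x)).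
  apply/funext => x; apply/ffunP => i; rewrite !ffunE /=.
  by case: splitP => j ij; rewrite !ffunE ij // -iterD addnC.
apply: shannon_law_comp; exact: finite_valued_pair.
Qed.

Lemma cvg_entropy_rate {J : finType} (lab : X -> J) : finite_valued lab ->
  cvgn (fun n => n%:R^-1 * block_entropy lab n) /\
  forall n, (0 < n)%N -> entropy_rate lab <= n%:R^-1 * block_entropy lab n.
Proof.
move=> mlab; apply: fekete => [n|m n]; first exact: block_entropy_ge0.
exact: block_entropyD.
Qed.

(** The itinerary of lab is guessed, one symbol at a time, from windows of length K
    of the itinerary of cyl.  The guesses multiply, so their logarithms add up, and
    by invariance each of the n terms has the same expectation. *)
Lemma block_entropy_le_conditional {J L : finType} (lab : X -> J) (cyl : X -> L)
    (K : nat) (phi : {ffun 'I_K -> L} -> J) (r : J -> J -> R) (n : nat) :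
  finite_valued lab -> finite_valued cyl ->
  (forall a b, 0 < r a b) -> (forall b, \sum_a r a b <= 1) ->
  block_entropy lab n <= block_entropy cyl (n + K)
    - n%:R * \sum_ab law rho (fun x => (lab x, phi (itinerary cyl K x))) ab * ln (r ab.1 ab.2).
Proof.
move=> mlab mcyl r0 r1.
have mu := finite_valued_itinerary (n := n) mlab.
have mw := finite_valued_itinerary (n := n + K) mcyl.
have lt_win (i : 'I_n) (j : 'I_K) : (i + j < n + K)%N.
  by rewrite -addnS leq_add // ltnW.
pose win (i : 'I_n) (w : {ffun 'I_(n + K) -> L}) : {ffun 'I_K -> L} :=
  [ffun j : 'I_K => w (Ordinal (lt_win i j))].
have := @shannon_law_pair_le_conditional _ _ R rho _ _ _ _
  (fun (u : {ffun 'I_n -> J}) w => \prod_i r (u i) (phi (win i w))) mu mw.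
have rw0 (u : {ffun 'I_n -> J}) w : 0 < \prod_i r (u i) (phi (win i w)).
  by apply: prodr_gt0.
move=> /(_ (fun u w => ltW (rw0 u w))).
have H w : \sum_(u : {ffun 'I_n -> J}) \prod_i r (u i) (phi (win i w)) <= 1.
  rewrite -(bigA_distr_bigA (fun i a => r a (phi (win i w)))).
  apply: (@le_trans _ _ (\prod_(i < n) (1 : R))); last by rewrite big1_eq.
  by apply: ler_prod => i _; rewrite r1 sumr_ge0 // => a _; exact: ltW.
move=> /(_ H (fun u w _ => rw0 u w)) {H} h.
apply: le_trans (shannon_law_comp rho fst (finite_valued_pair mu mw)) _.
apply: le_trans h _; rewrite lerD2l lerN2.
under [leRHS]eq_bigr do rewrite ln_prod // mulr_sumr.
rewrite exchange_big /= -[n in n%:R]card_ord -sum1_card natr_sum mulr_suml.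
apply: ler_sum => i _; rewrite mul1r.
pose g (uw : {ffun 'I_n -> J} * {ffun 'I_(n + K) -> L}) := (uw.1 i, phi (win i uw.2)).
rewrite -(@law_expectation_comp _ _ R rho _ _ g _ (fun ab => ln (r ab.1 ab.2))); last first.
  exact: finite_valued_pair.
rewrite -(@law_iter _ _ i); last first.
  apply: finite_valued_pair => //.
  by apply: (finite_valued_comp phi); exact: finite_valued_itinerary.
rewrite le_eqVlt; apply/orP; left; apply/eqP; apply: eq_bigr => ab _.
congr (law _ _ _ * _); apply/funext => x /=; rewrite /g /= !ffunE; congr (_, phi _).
by apply/ffunP => j; rewrite !ffunE /= -iterD addnC.
Qed.

(** Take r equal to 1 - de on a correct guess and spread de over the other labels:
    the cost per symbol is at most - ln (1 - de) plus the error probability times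
    - ln (de / k).  Choose de first, then the error probability. *)
Lemma entropy_rate_le_approx {J L : finType} (lab : X -> J) (cyl : X -> L) :
  finite_valued lab -> finite_valued cyl ->
  (forall e : R, 0 < e -> exists K, exists phi : {ffun 'I_K -> L} -> J,
     fine (rho [set x | lab x != phi (itinerary cyl K x)]) <= e) ->
  entropy_rate lab <= entropy_rate cyl.
Proof.
move=> mlab mcyl approx; apply/ler_addgt0Pr => e e0.
have [cvl infl] := cvg_entropy_rate mlab; have [cvc infc] := cvg_entropy_rate mcyl.
(* chosen so that - ln (1 - de) = e / 4 *)
pose de := 1 - expR (- (e / 4)).
have e4 : 0 < e / 4 by rewrite divr_gt0.
have de0 : 0 < de by rewrite subr_gt0 expR_lt1 oppr_lt0.
have de1 : de < 1 by rewrite ltrBlDr ltrDl expR_gt0.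
have lnde : ln (1 - de) = - (e / 4) by rewrite /de opprB addrC subrK expRK.
pose k : R := #|J|%:R + 1.
have k1 : 1 <= k by rewrite lerDr.
have k0 : 0 < k by exact: lt_le_trans k1.
have dk0 : 0 < de / k by rewrite divr_gt0.
have dk1 : de / k < 1.
  by rewrite ltr_pdivrMr // mul1r; exact: lt_le_trans k1.
have lndk : ln (de / k) < 0 by rewrite ln_lt0 // dk0.
pose r (a b : J) := if a == b then 1 - de else de / k.
have r0 a b : 0 < r a b by rewrite /r; case: ifP => // _; rewrite subr_gt0.
have r1 b : \sum_a r a b <= 1.
  rewrite (bigD1 b) //= {1}/r eqxx.
  under eq_bigr => a ab do rewrite /r (negbTE ab).
  rewrite sumr_const -mulr_natr.
  have : de / k * #|[pred i | i != b]|%:R <= de / k * k.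
    rewrite ler_wpM2l ?(ltW dk0) // (@le_trans _ _ #|J|%:R) ?lerDl //.
    by rewrite ler_nat max_card.
  by rewrite divfK ?gt_eqF //; lra.
have lndk' : 0 < - ln (de / k) by rewrite oppr_gt0.
have [K [phi bad]] := approx (e / 4 / - ln (de / k)) (divr_gt0 e4 lndk').
pose c2 x := (lab x, phi (itinerary cyl K x)).
have mc2 : finite_valued c2.
  apply: finite_valued_pair => //.
  by apply: (finite_valued_comp phi); exact: finite_valued_itinerary.
have cost : - \sum_ab law rho c2 ab * ln (r ab.1 ab.2) <= e / 2.
  rewrite (bigID (fun ab : J * J => ab.1 != ab.2)) /=.
  have -> : \sum_(i | i.1 != i.2) law rho c2 i * ln (r i.1 i.2) =
      fine (rho [set x | lab x != phi (itinerary cyl K x)]) * ln (de / k).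
    rewrite -[X in fine (rho X)]/[set x | (fun ab : J * J => ab.1 != ab.2) (c2 x)].
    rewrite (law_pred rho (fun ab : J * J => ab.1 != ab.2) mc2) mulr_suml.
    apply: eq_bigr => ab ab12.
    by rewrite /r (negbTE ab12).
  have h2 : - (e / 4) <= \sum_(i | ~~ (i.1 != i.2)) law rho c2 i * ln (r i.1 i.2).
    rewrite (eq_bigr (fun i => law rho c2 i * - (e / 4))); last first.
      by move=> ab; rewrite negbK => /eqP abE; rewrite /r abE eqxx lnde.
    rewrite -mulr_suml mulrN lerN2 ler_piMl ?(ltW e4) //.
    rewrite -(law_sum1 rho mc2) [leRHS](bigID (fun ab : J * J => ab.1 != ab.2)) /=.
    by rewrite lerDr sumr_ge0 // => *; exact: law_ge0.
  have h1 : fine (rho [set x | lab x != phi (itinerary cyl K x)]) * - ln (de / k) <= e / 4.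
    by rewrite -ler_pdivlMr ?oppr_gt0.
  by rewrite mulrN in h1; lra.
have step n : n%:R^-1 * block_entropy lab n <=
    n%:R^-1 * block_entropy cyl n + n%:R^-1 * block_entropy cyl K + e / 2.
  have [->|n0] := posnP n; first by rewrite invr0 !mul0r !add0r; lra.
  have nR : 0 < n%:R :> R by rewrite ltr0n.
  have := @block_entropy_le_conditional _ _ lab cyl K phi r n mlab mcyl r0 r1.
  rewrite -/c2 => h.
  rewrite -mulrDr ler_pdivrMl // [leRHS]mulrDr mulVKf ?gt_eqF //.
  apply: le_trans h _; apply: lerD; first exact: block_entropyD.
  by rewrite -mulrN ler_wpM2l.
have cv0 : (fun n => n%:R^-1 * block_entropy cyl K) @ \oo --> (0 : R).
  rewrite -[X in _ --> X](mul0r (block_entropy cyl K)); apply: cvgMr_tmp.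
  exact: cvg_idn_inv0.
suff : entropy_rate lab <= entropy_rate cyl + 0 + e / 2 by lra.
have cvr : (fun n => n%:R^-1 * block_entropy cyl n + n%:R^-1 * block_entropy cyl K + e / 2)
    @ \oo --> entropy_rate cyl + 0 + e / 2.
  apply: cvgD; last exact: cvg_cst.
  by apply: cvgD => //; exact: cvc.
apply: (ler_cvg_to cvl cvr); apply: nearW => n; exact: step.
Qed.

Lemma finite_partition_label {k : nat} (P : 'I_k -> set X) : finite_partition P ->
  exists2 lab : X -> 'I_k, finite_valued lab & P = fun a => lab @^-1` [set a].
Proof.
move=> [mP tP cP].
have ex x : exists a, P a x.
  have : (\bigcup_a P a) x by rewrite cP.
  by case=> a _ Pa; exists a.
have [lab labP] := choice ex.
have labE : P = fun a => lab @^-1` [set a].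
  apply/funext => a; apply/seteqP; split=> x /= => [Pa|<-//].
  by apply: tP => //; exists x; split.
by exists lab => // a; have := mP a; rewrite labE.
Qed.

Lemma label_finite_partition {k : nat} (lab : X -> 'I_k) : finite_valued lab ->
  finite_partition (fun a => lab @^-1` [set a]).
Proof.
move=> mlab; split=> //; last by apply/seteqP; split=> x // _; exists (lab x).
by move=> a b _ _ [x [/= <- <-]].
Qed.

Lemma partition_entropyE {k : nat} (lab : X -> 'I_k) :
  partition_entropy T rho (fun a => lab @^-1` [set a]) = entropy_rate lab.
Proof.
congr (limn _); apply/funext => n; congr (_ * _).
rewrite /join_entropy /block_entropy /shannon; congr (- _).
apply: eq_bigr => w _ /=.
suff -> : \bigcap_(i in [set: 'I_n]) (iter i T @^-1` (lab @^-1` [set w i])) =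
    itinerary lab n @^-1` [set w] by [].
apply/seteqP; split=> x /=.
  by move=> h; apply/ffunP => i; rewrite ffunE; exact: h.
by move=> <- i _ /=; rewrite ffunE.
Qed.

End invariant.

(** * Cylinders and Borel sets of the full shift *)

Section determined.
Context {R : realType} {d : nat}.
Local Notation Om := (fullshift R d).
Local Notation BOm := (borel_fullshift R d).

Definition agree (K : nat) (x y : Om) : Prop := forall i, (i < K)%N -> x i = y i.

(** Membership in B depends on the first K letters only.  These sets form an algebra
    and generate the Borel sets; keeping them as sets rather than unions of
    cylinders makes the change of depth K immediate. *)
Definition determined (K : nat) (B : set Om) : Prop :=
  forall x y, agree K x y -> B x -> B y.

Lemma agree_sym K x y : agree K x y -> agree K y x.
Proof. by move=> xy i /xy. Qed.

Lemma agree_le K L x y : (K <= L)%N -> agree L x y -> agree K x y.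
Proof. by move=> KL xy i iK; apply: xy; exact: leq_trans KL. Qed.

Lemma determined_le K L B : (K <= L)%N -> determined K B -> determined L B.
Proof. by move=> KL dB x y xy; apply: dB; exact: agree_le xy. Qed.

Lemma determinedC K B : determined K B -> determined K (~` B).
Proof. by move=> dB x y xy nBx By; apply: nBx; apply: dB By; exact: agree_sym. Qed.

Lemma determinedU K B C : determined K B -> determined K C -> determined K (B `|` C).
Proof. by move=> dB dC x y xy [Bx|Cx]; [left; exact: dB Bx|right; exact: dC Cx]. Qed.

Lemma determinedI K B C : determined K B -> determined K C -> determined K (B `&` C).
Proof. by move=> dB dC x y xy [Bx Cx]; split; [exact: dB Bx|exact: dC Cx]. Qed.

Lemma open_determined K B : determined K B -> open B.
Proof.
move=> dB; rewrite openE => x Bx; apply/nbhs_ballP.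
exists (2^-1 ^+ K.+1) => /=; first by rewrite exprn_gt0 // invr_gt0.
move=> y; rewrite ballEmdist /= => xy; apply: dB Bx => i iK.
by move/shift_dist_ltP : xy => -> //; exact: ltnW.
Qed.

Lemma open_agree (U : set Om) x : open U -> U x ->
  exists K, forall y, agree K x y -> U y.
Proof.
rewrite openE => oU Ux; have /nbhs_ballP[e /= e0 eU] := oU x Ux.
have [K Ke] : exists K, 2^-1 ^+ K.+1 < e.
  have := @cvg_geometric R 1 2^-1.
  rewrite ger0_norm ?invr_ge0 // invf_lt1 // ltr1n => /(_ isT) /cvgr_lt /(_ _ e0) [N _ NP].
  by exists N; have := NP N.+1 (leqnSn N); rewrite /geometric /= mul1r.
exists K.+1 => y xy; apply: eU; rewrite ballEmdist /=; apply: le_lt_trans Ke.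
by apply/ltW/shift_dist_ltP => i iK; apply: xy.
Qed.

Definition cylinder_sets : set (set Om) := [set B | exists K, determined K B].

(** An open U is the countable union over K of the sets of points whose whole
    cylinder of depth K lies in U. *)
Lemma borel_cylinder_sets : @measurable _ BOm = <<s cylinder_sets >>.
Proof.
apply/seteqP; split; last first.
  apply: smallest_sub; first exact: sigma_algebra_measurable.
  by move=> B [K dB]; apply: sub_sigma_algebra; exact: open_determined dB.
apply: smallest_sub; first exact: smallest_sigma_algebra.
move=> U oU.
have -> : U = \bigcup_K [set x | forall y, agree K x y -> U y].
  apply/seteqP; split=> [x Ux|x [K _ /= KU]]; last by apply: KU => i.
  by have [K KU] := open_agree oU Ux; exists K.
have [_ _ sU] := smallest_sigma_algebra (setT : set Om) cylinder_sets.
apply: sU => K; apply: sub_sigma_algebra; exists K => x y xy xU z yz; apply: xU.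
by move=> i iK; rewrite xy // yz.
Qed.

Lemma determined_measurable K (B : set Om) : determined K B -> measurable (B : set BOm).
Proof. by move=> dB; apply: sub_sigma_algebra; exact: open_determined dB. Qed.

Lemma measurable_fun_determined (f : Om -> Om) :
  (forall K, exists L, forall x y, agree L x y -> agree K (f x) (f y)) ->
  measurable_fun setT (f : BOm -> BOm).
Proof.
move=> fc; have := @measurability _ _ BOm BOm setT f cylinder_sets borel_cylinder_sets.
apply.
move=> _ [B [K dB] <-]; have [L LK] := fc K.
rewrite setTI; apply: (@determined_measurable L) => x y xy /=.
by apply: dB; exact: LK.
Qed.

Lemma measurable_shift_map : measurable_fun setT (@shift_map R d : BOm -> BOm).
Proof.
by apply: measurable_fun_determined => K; exists K.+1 => x y xy i iK; exact: xy.
Qed.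

Lemma iter_shift_map i x n : iter i (@shift_map R d) x n = x (i + n)%N.
Proof.
elim: i n => [|i IH] n //; first by rewrite iterS /shift_map IH addSnnS.
Qed.

Lemma agree_iter_shift K i x y : agree (i + K) x y ->
  agree K (iter i (@shift_map R d) x) (iter i (@shift_map R d) y).
Proof. by move=> xy j jK; rewrite !iter_shift_map; apply: xy; rewrite ltn_add2l. Qed.

Definition first_letter (x : BOm) : 'I_d.+1 := x 0%N.

Definition word (n : nat) (x : BOm) : {ffun 'I_n -> 'I_d.+1} :=
  itinerary (X := BOm) (T := @shift_map R d) first_letter n x.

Lemma wordE n x i : word n x i = x i.
Proof. by rewrite ffunE /first_letter iter_shift_map addn0. Qed.

Lemma word_agree n x y : word n x = word n y <-> agree n x y.
Proof.
split=> [/ffunP xy i ni|xy]; last by apply/ffunP => i; rewrite !wordE xy.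
by have := xy (Ordinal ni); rewrite !wordE.
Qed.

(** A chosen point of the cylinder of w, at which Birkhoff sums are evaluated. *)
Definition extend (n : nat) (w : {ffun 'I_n -> 'I_d.+1}) : Om :=
  fun k => if insub k is Some i then w i else ord0.

Lemma word_extend n w : word n (extend w) = w.
Proof.
by apply/ffunP => i; rewrite wordE /extend valK.
Qed.

Lemma agree_extend n x : agree n (extend (word n x)) x.
Proof. by apply/word_agree; rewrite word_extend. Qed.

Lemma finite_valued_first_letter : finite_valued first_letter.
Proof.
move=> a; apply: (@determined_measurable 1) => x y xy /=.
by rewrite /first_letter xy.
Qed.

Lemma finite_valued_word n : finite_valued (word n).
Proof. exact: (finite_valued_itinerary measurable_shift_map finite_valued_first_letter). Qed.

Section approximation.
Variable rho : probability BOm R.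

Definition approximable (B : set BOm) : Prop :=
  measurable B /\ forall e : R, 0 < e -> exists K, exists2 S : set BOm,
    determined K S & (rho ((B `\` S) `|` (S `\` B)) <= e%:E)%E.

Lemma approximable_determined K B : determined K B -> approximable B.
Proof.
move=> dB; split; first exact: determined_measurable dB.
move=> e e0; exists K, B => //; rewrite !setDv setU0 measure0 lee_fin.
exact: ltW.
Qed.

Lemma approximableC B : approximable B -> approximable (~` B).
Proof.
move=> [mB aB]; split; first exact: measurableC.
move=> e /aB [K [S dS Se]]; exists K, (~` S); first exact: determinedC.
by rewrite !setDE !setCK [~` _ `&` _]setIC [X in _ `|` X]setIC setUC -!setDE.
Qed.

Lemma approximable_near (B : set BOm) : measurable B ->
  (forall e : R, 0 < e -> exists2 C, approximable C &
     (rho ((B `\` C) `|` (C `\` B)) <= e%:E)%E) ->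
  approximable B.
Proof.
move=> mB aB; split=> // e e0.
have e2 : 0 < e / 2 by rewrite divr_gt0.
have [C [mC aC] BC] := aB _ e2; have [K [S dS CS]] := aC _ e2.
have mS := determined_measurable dS.
exists K, S => //; rewrite (splitr e) EFinD; apply: le_trans (leeD BC CS).
apply: le_trans (measureU2 _ _ _) => //.
- apply: le_measure; rewrite ?inE.
  + by do !(apply: measurableU || apply: measurableD).
  + by do !(apply: measurableU || apply: measurableD).
  + move=> x /=; have [Cx|nCx] := pselect (C x); tauto.
- by do !(apply: measurableU || apply: measurableD).
- by do !(apply: measurableU || apply: measurableD).
Qed.

Lemma approximableU B C : approximable B -> approximable C -> approximable (B `|` C).
Proof.
move=> [mB aB] [mC aC]; split; first exact: measurableU.
move=> e e0; have e2 : 0 < e / 2 by rewrite divr_gt0.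
have [K [S dS BS]] := aB _ e2; have [L [V dV CV]] := aC _ e2.
have mS := determined_measurable dS; have mV := determined_measurable dV.
exists (maxn K L), (S `|` V).
  by apply: determinedU; [apply: determined_le dS|apply: determined_le dV];
    rewrite (leq_maxl, leq_maxr).
rewrite (splitr e) EFinD; apply: le_trans (leeD BS CV).
apply: le_trans (measureU2 _ _ _) => //.
- apply: le_measure; rewrite ?inE.
  + by do !(apply: measurableU || apply: measurableD).
  + by do !(apply: measurableU || apply: measurableD).
  + move=> x /=; tauto.
- by do !(apply: measurableU || apply: measurableD).
- by do !(apply: measurableU || apply: measurableD).
Qed.

(** The finite unions increase to the whole union, so by continuity from below some
    finite union misses only a set of small measure. *)
Lemma approximable_bigcup (F : (set BOm)^nat) :
  (forall n, approximable (F n)) -> approximable (\bigcup_n F n).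
Proof.
move=> aF; have mF n := (aF n).1.
pose G n := \big[setU/set0]_(i < n.+1) F i.
have aG n : approximable (G n).
  rewrite /G; elim/big_ind : _ => //; last exact: approximableU.
  exact: (@approximable_determined 0).
have GF : \bigcup_n G n = \bigcup_n F n by exact: bigcup_bigsetU_bigcup.
have mU : measurable (\bigcup_n F n) by exact: bigcupT_measurable.
apply: approximable_near => // e e0.
have cv : rho \o G @ \oo --> rho (\bigcup_n F n).
  rewrite -GF; apply: nondecreasing_cvg_mu; first by move=> n; exact: (aG n).1.
    by rewrite GF.
  move=> m n mn; apply/subsetPset; rewrite /G -!bigcup_mkord => x [i /= im Fx].
  by exists i => //=; exact: leq_trans mn.
have fU : rho (\bigcup_n F n) \is a fin_num by exact: fin_num_measure.
have {}cv : fine \o (rho \o G) @ \oo --> fine (rho (\bigcup_n F n)).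
  by apply: fine_cvg; rewrite fineK.
have [N _ /(_ N (leqnn N)) /= dN] := (cvgrPdist_le _ _).1 cv e e0.
exists (G N) => //.
have GNF : G N `<=` \bigcup_n F n by rewrite -GF; exact: bigcup_sup.
rewrite [X in _ `|` X](_ : _ = set0) ?setU0; last by rewrite setD_eq0.
rewrite measureD //; last 2 first.
- exact: (aG N).1.
- by rewrite -ge0_fin_numE.
rewrite setIidr //.
have := le_trans (ler_norm _) dN.
by rewrite -lee_fin EFinB !fineK ?fin_num_measure //; exact: (aG N).1.
Qed.

(** The approximable sets form a sigma-algebra containing the cylinders. *)
Lemma measurable_approximable B : measurable B -> approximable B.
Proof.
rewrite borel_cylinder_sets; apply: (@smallest_sub _ _ _ approximable).
  split.
  - exact: (@approximable_determined 0).
  - by move=> C aC; rewrite setTD; exact: approximableC.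
  - exact: approximable_bigcup.
by move=> C [K dC]; exact: approximable_determined dC.
Qed.

End approximation.
End determined.

(** * The cylinder partition carries the whole entropy *)

Section generator.
Context {R : realType} {d : nat}.
Local Notation Om := (fullshift R d).
Local Notation BOm := (borel_fullshift R d).
Local Notation sh := (@shift_map R d : BOm -> BOm).
Variable rho : probability BOm R.
Hypothesis rhoT : invariant_probabilities sh rho.

(** Approximate each level set of lab by a set S_a determined by K letters, with K
    common to all labels, and let phi pick a label whose S_a contains the word.  If
    phi is wrong at x, then x lies in the symmetric difference of some level set
    and its approximation. *)
Lemma label_word_approx {J : finType} (lab : BOm -> J) : finite_valued lab ->
  forall e : R, 0 < e -> exists K, exists phi : {ffun 'I_K -> 'I_d.+1} -> J,
    fine (rho [set x | lab x != phi (word K x)]) <= e.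
Proof.
move=> mlab e e0.
pose e' := e / (#|J|%:R + 1).
have J0 : 0 < #|J|%:R + 1 :> R by rewrite ltr_wpDl.
have e'0 : 0 < e' by rewrite divr_gt0.
have ex a : exists KS : nat * set BOm, @determined R d KS.1 KS.2 /\
    (rho (((lab @^-1` [set a]) `\` KS.2) `|` (KS.2 `\` (lab @^-1` [set a]))) <= e'%:E)%E.
  have [K [S dS Se]] := (measurable_approximable rho (mlab a)).2 e' e'0.
  by exists (K, S).
have [KS KSP] := choice ex.
pose K := (\max_a (KS a).1)%N.
have dS a : @determined R d K (KS a).2.
  by apply: determined_le (KSP a).1; exact: leq_bigmax.
pose phi (w : {ffun 'I_K -> 'I_d.+1}) : J :=
  if [pick a | `[< (KS a).2 (extend (R := R) w) >]] is Some a then a else lab point.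
exists K, phi.
have phiE x : phi (word K x) != lab x ->
    (forall b, (KS b).2 x <-> lab x = b) -> False.
  rewrite /phi; case: pickP => [b /asboolP Sb|nS] /eqP neq h.
    have /h hb : (KS b).2 x by apply: dS Sb; exact: agree_extend.
    by apply: neq; rewrite hb.
  have /asboolP := negbT (nS (lab x)); apply.
  have /h : lab x = lab x by []. 
  by apply: dS => i iK; rewrite (@agree_extend R d K x i iK).
pose bad a := ((lab @^-1` [set a]) `\` (KS a).2) `|` ((KS a).2 `\` (lab @^-1` [set a])).
have mbad a : measurable (bad a).
  have mS := determined_measurable (dS a).
  by apply: measurableU; apply: measurableD.
have mlw : measurable [set x | lab x != phi (word K x)].
  have m2 := finite_valued_pair mlab (finite_valued_comp phi (@finite_valued_word R d K)).
  exact: (finite_valued_pred (fun ab : J * J => ab.1 != ab.2) m2).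
apply: (@le_trans _ _ (\sum_a fine (rho (bad a)))).
  apply: finite_union_bound => // x /= neq.
  apply: contrapT => nbad; apply: (phiE x); first by rewrite eq_sym.
  move=> b; split=> h; apply: contrapT => nh; apply: nbad.
  - by exists b; right.
  - by exists b; left.
apply: (@le_trans _ _ (\sum_(a : J) e')).
  apply: ler_sum => a _; have := (KSP a).2; rewrite -lee_fin fineK ?fin_num_measure //.
rewrite sumr_const -mulr_natr /e' mulrAC ler_pdivrMr //.
by rewrite ler_wpM2l ?lerDl // ltW.
Qed.

Definition cylinder_entropy : R := entropy_rate (T := sh) (rho := rho) (@first_letter R d).

Lemma ks_entropyE : ks_entropy sh rho = cylinder_entropy%:E.
Proof.
apply/eqP; rewrite eq_le; apply/andP; split.
  apply: ge_ereal_sup => _ [k [P [fP ->]]]; rewrite lee_fin.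
  have [lab mlab ->] := finite_partition_label fP.
  rewrite partition_entropyE.
  apply: entropy_rate_le_approx => //; first exact: measurable_shift_map.
    exact: finite_valued_first_letter.
  exact: label_word_approx.
apply: ereal_sup_ubound; exists d.+1, (fun a => (@first_letter R d) @^-1` [set a]).
split; last by rewrite partition_entropyE.
apply: label_finite_partition; exact: finite_valued_first_letter.
Qed.

End generator.

(** * Integrals of bounded functions and Birkhoff sums *)

Section bounded_measurable_theory.
Context {dX : measure_display} {X : measurableType dX} {R : realType}.
Variable rho : probability X R.
Implicit Types f g : X -> R.

Definition bounded_measurable (f : X -> R) : Prop :=
  measurable_fun setT f /\ exists K, forall x, `|f x| <= K.

Lemma bounded_measurable_integrable f :
  bounded_measurable f -> rho.-integrable setT (EFin \o f).
Proof.
move=> [mf [K fK]]; apply: measurable_bounded_integrable => //.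
  by rewrite -ge0_fin_numE // fin_num_measure.
exists K; split; first exact: num_real.
by move=> M KM x _; apply: le_trans (fK x) (ltW KM).
Qed.

Lemma bounded_measurable_cst (c : R) : bounded_measurable (fun _ : X => c).
Proof. by split; [exact: measurable_cst|exists `|c|]. Qed.

Lemma bounded_measurableD f g : bounded_measurable f -> bounded_measurable g ->
  bounded_measurable (fun x => f x + g x).
Proof.
move=> [mf [K fK]] [mg [L gL]]; split; first exact: measurable_funD.
by exists (K + L) => x; apply: le_trans (ler_normD _ _) (lerD _ _).
Qed.

Lemma bounded_measurableM f g : bounded_measurable f -> bounded_measurable g ->
  bounded_measurable (fun x => f x * g x).
Proof.
move=> [mf [K fK]] [mg [L gL]]; split; first exact: measurable_funM.
by exists (K * L) => x; rewrite normrM ler_pM.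
Qed.

Lemma bounded_measurableZ (c : R) f : bounded_measurable f ->
  bounded_measurable (fun x => c * f x).
Proof. by move=> bf; apply: bounded_measurableM => //; exact: bounded_measurable_cst. Qed.

Lemma bounded_measurable_sqr f : bounded_measurable f ->
  bounded_measurable (fun x => f x ^+ 2).
Proof. by move=> bf; apply: bounded_measurableM. Qed.

Lemma bounded_measurable_comp (T : X -> X) f : measurable_fun setT T ->
  bounded_measurable f -> bounded_measurable (f \o T).
Proof.
by move=> mT [mf [K fK]]; split; [exact: measurableT_comp|exists K => x; exact: fK].
Qed.

Lemma bounded_measurable_finite {J : finType} (c : X -> J) (G : J -> R) :
  finite_valued c -> bounded_measurable (fun x => G (c x)).
Proof.
move=> mc; split.
  move=> _ B mB; rewrite setTI.
  have := finite_valued_pred (fun j => `[< B (G j) >]) mc.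
  by congr (measurable _); apply/seteqP; split=> x /= /asboolP.
exists (\sum_j `|G j|) => x; rewrite (bigD1 (c x)) //= lerDl sumr_ge0 //.
Qed.

Lemma Rintegral_boundedD f g : bounded_measurable f -> bounded_measurable g ->
  \int[rho]_x (f x + g x) = \int[rho]_x f x + \int[rho]_x g x.
Proof. by move=> bf bg; apply: RintegralD => //; exact: bounded_measurable_integrable. Qed.

Lemma Rintegral_boundedZl (c : R) f : bounded_measurable f ->
  \int[rho]_x (c * f x) = c * \int[rho]_x f x.
Proof. by move=> bf; apply: RintegralZl => //; exact: bounded_measurable_integrable. Qed.

Lemma le_Rintegral_bounded f g : bounded_measurable f -> bounded_measurable g ->
  (forall x, f x <= g x) -> \int[rho]_x f x <= \int[rho]_x g x.
Proof.
by move=> bf bg fg; apply: le_Rintegral => //; exact: bounded_measurable_integrable.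
Qed.

Lemma Rintegral_probability_cst (c : R) : \int[rho]_x c = c.
Proof.
rewrite Rintegral_cst // [X in fine X](_ : _ = 1%E) ?mulr1 //.
exact: probability_setT.
Qed.

Lemma Rintegral_dist_le f g (c : R) : bounded_measurable f -> bounded_measurable g ->
  (forall x, `|f x - g x| <= c) -> `|\int[rho]_x f x - \int[rho]_x g x| <= c.
Proof.
move=> bf bg fg; have bc := bounded_measurable_cst c.
have h1 : \int[rho]_x f x <= \int[rho]_x g x + c.
  rewrite -[X in _ + X]Rintegral_probability_cst -Rintegral_boundedD //.
  apply: le_Rintegral_bounded => // [|x]; first exact: bounded_measurableD.
  by have := fg x; rewrite ler_norml => /andP[_]; rewrite lerBlDl.
have h2 : \int[rho]_x g x <= \int[rho]_x f x + c.
  rewrite -[X in _ + X]Rintegral_probability_cst -Rintegral_boundedD //.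
  apply: le_Rintegral_bounded => // [|x]; first exact: bounded_measurableD.
  by have := fg x; rewrite ler_norml => /andP[+ _]; lra.
by rewrite ler_norml; apply/andP; split; lra.
Qed.

Lemma Rintegral_invariant (T : X -> X) f : measurable_fun setT T ->
  invariant_probabilities T rho -> bounded_measurable f ->
  \int[rho]_x f (T x) = \int[rho]_x f x.
Proof.
move=> mT rhoT bf; rewrite /Rintegral; congr fine.
have bfT := bounded_measurable_comp mT bf.
rewrite -[LHS](@integral_pushforward _ _ _ _ R T mT rho setT (EFin \o f)) //.
- by apply: eq_measure_integral => B mB _; exact: rhoT.
- by apply/measurable_EFinP; exact: bf.1.
- exact: bounded_measurable_integrable.
Qed.

(** Everywhere f is within c + K 1_E of a, where E is the exceptional null set, and
    the right-hand side integrates to c. *)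
Lemma Rintegral_near_full (f : X -> R) (a c K : R) :
  bounded_measurable f -> (forall x, `|f x - a| <= K) -> 0 <= c ->
  fine (rho [set x | `|f x - a| <= c]) = 1 -> `|\int[rho]_x f x - a| <= c.
Proof.
move=> bf fK c0; set G := [set x | _] => G1.
have mG : measurable G.
  have := bounded_measurableD bf (bounded_measurable_cst (- a)) => -[mfa _].
  have := measurableT_comp (@normr_measurable R setT) mfa.
  move=> /(_ measurableT _ (@measurable_itv R `]-oo, c])).
  by rewrite setTI; congr (measurable _); apply/seteqP; split=> x /=; rewrite in_itv.
pose g x : bool := `[< G x >].
have mg : finite_valued g.
  move=> [].
    by move: (mG); congr (measurable _); apply/seteqP; split=> x /asboolP.
  have := measurableC mG; congr (measurable _); apply/seteqP; split=> x /=.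
    by move=> nG; apply/asboolPn.
  by move=> /asboolPn.
pose h (b : bool) : R := c + K * (~~ b)%:R.
have bh : bounded_measurable (fun x => h (g x)) by exact: bounded_measurable_finite.
have Ih : \int[rho]_x h (g x) = c.
  rewrite (Rintegral_finite_valued rho h mg) big_bool /=.
  have l1 : law rho g true = 1.
    by rewrite -G1; congr (fine (rho _)); apply/seteqP; split=> x /asboolP.
  have := law_sum1 rho mg; rewrite big_bool /= l1 => /eqP.
  rewrite -subr_eq0 addrAC subrr add0r => /eqP ->.
  by rewrite /h /= mulr0 addr0 mul1r mul0r addr0.
have fh x : `|f x - a| <= h (g x).
  rewrite /h /g; case: asboolP => [Gx|nGx] /=; first by rewrite mulr0 addr0.
  by rewrite mulr1; apply: le_trans (fK x) _; rewrite lerDr.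
have ba := bounded_measurable_cst a.
have h1 : \int[rho]_x f x <= a + c.
  rewrite -[in leRHS]Ih -[X in X + _](Rintegral_probability_cst a) -Rintegral_boundedD //.
  apply: le_Rintegral_bounded => //; first exact: bounded_measurableD.
  by move=> x; have := fh x; rewrite ler_norml => /andP[_]; rewrite lerBlDl.
have h2 : a <= \int[rho]_x f x + c.
  rewrite -[in leRHS]Ih -[leLHS](Rintegral_probability_cst a) -Rintegral_boundedD //.
  apply: le_Rintegral_bounded => //; first exact: bounded_measurableD.
  by move=> x; have := fh x; rewrite ler_norml => /andP[+ _]; lra.
by rewrite ler_norml; apply/andP; split; lra.
Qed.

End bounded_measurable_theory.

Section birkhoff.
Context {R : realType} {X : Type} (T : X -> X) (A : X -> R).

Definition birkhoff_sum (n : nat) (x : X) : R := \sum_(i < n) A (iter i T x).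

Lemma birkhoff_meanE n x : birkhoff_mean T A n x = n%:R^-1 * birkhoff_sum n x.
Proof. by []. Qed.

Lemma birkhoff_sumD m n x :
  birkhoff_sum (m + n) x = birkhoff_sum m x + birkhoff_sum n (iter m T x).
Proof.
rewrite /birkhoff_sum big_split_ord /=; congr (_ + _).
by apply: eq_bigr => i _; rewrite addnC iterD.
Qed.

Lemma birkhoff_sumM M N x :
  birkhoff_sum (M * N) x = \sum_(i < M) birkhoff_sum N (iter (i * N) T x).
Proof.
elim: M => [|M IH]; first by rewrite mul0n /birkhoff_sum !big_ord0.
by rewrite mulSnr birkhoff_sumD IH big_ord_recr.
Qed.

Lemma birkhoff_sum_bound (K : R) n x : (forall x, `|A x| <= K) ->
  `|birkhoff_sum n x| <= n%:R * K.
Proof.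
move=> AK; apply: le_trans (ler_norm_sum _ _ _) _.
by rewrite mulrC mulr_natr -[n in _ *+ n]card_ord -sumr_const; apply: ler_sum.
Qed.

End birkhoff.

Section birkhoff_invariant.
Context {dX : measure_display} {X : measurableType dX} {R : realType}.
Context {T : X -> X} {rho : probability X R} {A : X -> R}.
Hypothesis mT : measurable_fun setT T.
Hypothesis rhoT : invariant_probabilities T rho.
Hypothesis bA : bounded_measurable A.

Lemma bounded_measurable_birkhoff_sum n : bounded_measurable (birkhoff_sum T A n).
Proof.
elim: n => [|n IH].
  rewrite (_ : birkhoff_sum T A 0 = fun=> 0); last first.
    by apply/funext => x; rewrite /birkhoff_sum big_ord0.
  exact: bounded_measurable_cst.
rewrite (_ : birkhoff_sum T A n.+1 = fun x => birkhoff_sum T A n x + (A \o iter n T) x).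
  apply: bounded_measurableD => //; apply: bounded_measurable_comp => //.
  exact: measurable_iter.
by apply/funext => x; rewrite /birkhoff_sum big_ord_recr.
Qed.

Lemma bounded_measurable_birkhoff_mean n : bounded_measurable (birkhoff_mean T A n).
Proof. by apply: bounded_measurableZ; exact: bounded_measurable_birkhoff_sum. Qed.

Lemma Rintegral_birkhoff_sum n :
  \int[rho]_x birkhoff_sum T A n x = n%:R * \int[rho]_x A x.
Proof.
elim: n => [|n IH].
  under eq_Rintegral do rewrite /birkhoff_sum big_ord0.
  by rewrite Rintegral_probability_cst mul0r.
under eq_Rintegral do rewrite -addn1 birkhoff_sumD.
have b1 := bounded_measurable_birkhoff_sum 1.
rewrite Rintegral_boundedD; first last.
- by apply: (bounded_measurable_comp (measurable_iter mT n)).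
- exact: bounded_measurable_birkhoff_sum.
rewrite IH -natr1 mulrDl mul1r; congr (_ + _).
have E x : birkhoff_sum T A 1 x = A x by rewrite /birkhoff_sum big_ord1.
under eq_Rintegral do rewrite E.
rewrite (@Rintegral_invariant _ _ _ rho (iter n T)) //; first exact: measurable_iter.
by move=> B mB; exact: invariant_iter.
Qed.

Lemma Rintegral_birkhoff_mean n : (0 < n)%N ->
  \int[rho]_x birkhoff_mean T A n x = \int[rho]_x A x.
Proof.
move=> n0; rewrite Rintegral_boundedZl; last exact: bounded_measurable_birkhoff_sum.
by rewrite Rintegral_birkhoff_sum mulKf // pnatr_eq0 -lt0n.
Qed.

(** Since (a + b)^2 / (m + n) <= a^2 / m + b^2 / n, the integrals of S_n ^ 2 / n
    form a subadditive sequence. *)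
Lemma cvg_Rintegral_birkhoff_sqr :
  cvgn (fun n => \int[rho]_x (birkhoff_mean T A n x ^+ 2)).
Proof.
pose u n := n%:R^-1 * \int[rho]_x (birkhoff_sum T A n x ^+ 2).
have bS n := bounded_measurable_sqr (bounded_measurable_birkhoff_sum n).
have E n : \int[rho]_x (birkhoff_mean T A n x ^+ 2) = n%:R^-1 * u n.
  under eq_Rintegral do rewrite birkhoff_meanE exprMn.
  by rewrite Rintegral_boundedZl // /u mulrA -expr2.
rewrite (_ : (fun n => _) = fun n => n%:R^-1 * u n); last exact/funext.
apply: (proj1 (fekete _ _)) => [n|m n].
  by rewrite mulr_ge0 // Rintegral_ge0 // => x _; exact: sqr_ge0.
have [->|m0] := posnP m.
  by rewrite add0n lerDr mulr_ge0 // Rintegral_ge0 // => x _; exact: sqr_ge0.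
have [->|n0] := posnP n.
  by rewrite addn0 lerDl mulr_ge0 // Rintegral_ge0 // => x _; exact: sqr_ge0.
have -> : u n = n%:R^-1 * \int[rho]_x (birkhoff_sum T A n (iter m T x) ^+ 2).
  congr (_ * _); rewrite [RHS](@Rintegral_invariant _ _ _ rho (iter m T)
      (fun x => birkhoff_sum T A n x ^+ 2)) //; first exact: measurable_iter.
  by move=> B mB; exact: invariant_iter.
have bSm := bounded_measurable_comp (measurable_iter mT m) (bS n).
rewrite /u -!Rintegral_boundedZl // -Rintegral_boundedD; [|exact: bounded_measurableZ..].
apply: le_Rintegral_bounded => [||x]; [exact: bounded_measurableZ| |].
  by apply: bounded_measurableD; exact: bounded_measurableZ.
rewrite birkhoff_sumD; set a := birkhoff_sum _ _ _ _; set b := birkhoff_sum _ _ _ _.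
have mR : 0 < m%:R :> R by rewrite ltr0n.
have nR : 0 < n%:R :> R by rewrite ltr0n.
rewrite natrD; move: (m%:R : R) (n%:R : R) mR nR => M N M0 N0.
have MN : 0 < M + N by rewrite addr_gt0.
rewrite ler_pdivrMl // -subr_ge0.
have -> : (M + N) * (M^-1 * a ^+ 2 + N^-1 * b ^+ 2) - (a + b) ^+ 2 =
   (N * a - M * b) ^+ 2 / (M * N) by field; rewrite !gt_eqF.
by rewrite divr_ge0 ?sqr_ge0 // mulr_ge0 ?ltW.
Qed.

End birkhoff_invariant.

(** * Hölder potentials *)

Section hoelder.
Context {R : realType} {d : nat} {A : fullshift R d -> R}.
Hypothesis A_hoelder : hoelder_continuous A.
Local Notation Om := (fullshift R d).
Local Notation BOm := (borel_fullshift R d).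
Local Notation sh := (@shift_map R d).

Lemma hoelder_agree : exists C theta : R, [/\ 0 <= C, 0 < theta < 1 &
  forall k x y, agree k x y -> `|A x - A y| <= C * theta ^+ k].
Proof.
have [C [a [C0 /andP[a0 a1] AC]]] := A_hoelder.
have h0 : 0 < 2^-1 :> R by rewrite invr_gt0.
have h1 : 2^-1 < 1 :> R by rewrite invf_lt1 // ltr1n.
exists C, (2^-1 `^ a); split=> //.
  rewrite powR_gt0 //=.
  by have := gt0_ltr_powR a0 (ltW h0) (ltW ltr01) h1; rewrite powR1.
move=> k x y xy; apply: le_trans (AC x y) _; rewrite ler_wpM2l //.
rewrite -powR_mulrn ?powR_ge0 // powRAC powR_mulrn ?(ltW h0) //.
apply: ge0_ler_powR; rewrite ?(ltW a0) ?nnegrE ?exprn_ge0 ?(ltW h0) //.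
  exact: mdist_ge0.
case: k xy => [|k] xy; last by apply/ltW/shift_dist_ltP => i ik; exact: xy.
rewrite expr0 /mdist /= /shift_dist; case: pselect => // e.
by rewrite exprn_ile1 // ltW.
Qed.

Lemma hoelder_bound : exists2 K : R, 0 < K & forall x, `|A x| <= K.
Proof.
have [C [th [C0 _ AC]]] := hoelder_agree.
exists (`|A point| + C + 1) => [|x]; first by rewrite ltr_pwDr // addr_ge0.
have xp : agree 0 x point by move=> i.
have := AC 0%N x point xp.
rewrite expr0 mulr1 => h.
have : `|A x| <= `|A point| + `|A x - A point|.
  by rewrite -[A x in leLHS](subrK (A point)) addrC ler_normD.
lra.
Qed.

(** The distances of the shifted points decrease geometrically, so the differences
    sum to a constant independent of n. *)
Lemma hoelder_distortion : exists2 C : R, 0 <= C & forall n x y, agree n x y ->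
  `|birkhoff_sum sh A n x - birkhoff_sum sh A n y| <= C.
Proof.
have [C [th [C0 /andP[th0 th1] AC]]] := hoelder_agree.
have th1' : 0 < 1 - th by rewrite subr_gt0.
pose C' := C * th / (1 - th).
have C'0 : 0 <= C' by rewrite divr_ge0 ?mulr_ge0 ?(ltW th0) ?(ltW th1').
exists C' => // n x y xy; apply: (@le_trans _ _ (C' * (1 - th ^+ n))); last first.
  by rewrite ler_piMr // gerBl exprn_ge0 // (ltW th0).
elim: n x y xy => [|n IH] x y xy.
  by rewrite /birkhoff_sum !big_ord0 subrr normr0 expr0 subrr mulr0.
rewrite -add1n !birkhoff_sumD /birkhoff_sum !big_ord1 /= -/(birkhoff_sum _ _ _ _).
rewrite -/(birkhoff_sum sh A n (sh y)) opprD addrACA.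
apply: le_trans (ler_normD _ _) _.
have := IH (sh x) (sh y) (fun i ni => xy i.+1 ni).
have := AC n.+1 x y xy.
have -> : C' * (1 - th ^+ (1 + n)) = C * th ^+ n.+1 + C' * (1 - th ^+ n).
  by rewrite /C' add1n exprS; field; rewrite gt_eqF.
exact: lerD.
Qed.

Lemma hoelder_open_preimage (U : set R) : open U -> open (A @^-1` U).
Proof.
have [C [th [C0 /andP[th0 th1] AC]]] := hoelder_agree.
move=> oU; rewrite openE => x Ux.
have /nbhs_ballP[e /= e0 eU] : nbhs (A x) U by exact: open_nbhs_nbhs.
have [k ke] : exists k, C * th ^+ k < e.
  have := @cvg_geometric R C th; rewrite ger0_norm ?(ltW th0) // th1.
  move=> /(_ isT) /cvgr_lt /(_ _ e0) [N _ NP].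
  by exists N; have := NP N (leqnn N).
apply/nbhs_ballP; exists (2^-1 ^+ k.+1) => /=; first by rewrite exprn_gt0 // invr_gt0.
move=> y; rewrite ballEmdist /= => /shift_dist_ltP xy; apply: eU.
apply: le_lt_trans ke; apply: AC => i ik; apply: xy; exact: ltnW.
Qed.

Lemma hoelder_bounded_measurable : bounded_measurable (A : BOm -> R).
Proof.
split; last by have [K _ AK] := hoelder_bound; exists K.
have := @measurability _ _ BOm _ setT (A : BOm -> R) _ (RGenOpens.measurableE R).
apply; move=> _ [_ [a [b ->]] <-]; rewrite setTI; apply: sub_sigma_algebra.
by apply: hoelder_open_preimage; exact: interval_open.
Qed.

End hoelder.

(** * Block codes of the uniform product measure *)

Lemma average_probability {dX : measure_display} {X : measurableType dX} {R : realType}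
    (mu : probability X R) (n : nat) (f : nat -> X -> X) :
  (0 < n)%N -> (forall k, measurable_fun setT (f k)) ->
  exists rho : probability X R, forall B, measurable B ->
    fine (rho B) = n%:R^-1 * \sum_(k < n) fine (mu (f k @^-1` B)).
Proof.
move=> n0 mf.
have ex k : exists P : {measure set X -> \bar R}, forall B, P B = mu (f k @^-1` B).
  by unshelve eexists (pushforward mu (f k)).
have [P PE] := choice ex.
have mfB k B : measurable B -> measurable (f k @^-1` B).
  by move=> mB; rewrite -[_ @^-1` _]setTI; exact: mf.
pose m : {measure set X -> \bar R} := msum P n.
have S B : measurable B -> m B = (\sum_(k < n) fine (mu (f k @^-1` B)))%:E.
  move=> mB; rewrite /m /= /msum -sumEFin; apply: eq_bigr => k _.
  by rewrite PE fine_probability //; exact: mfB.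
have S1 : m setT = (n%:R)%:E.
  rewrite S //; congr EFin.
  rewrite (eq_bigr (fun=> 1)) ?sumr_const ?card_ord //.
  by move=> k _; rewrite preimage_setT probability_setT.
exists (mnormalize m mu) => B mB.
rewrite /= /mnormalize S1 eqe pnatr_eq0 eqn0Ngt n0 /= S //.
by rewrite -EFinM /= mulrC.
Qed.

Section uniform_measure.
Context {R : realType} {d : nat}.
Local Notation Om := (fullshift R d).
Local Notation BOm := (borel_fullshift R d).
Local Notation sh := (@shift_map R d : BOm -> BOm).
Variable mu : probability BOm R.
Hypothesis mu_prod : uniform_product mu.

Lemma uniform_word n (w : {ffun 'I_n -> 'I_d.+1}) :
  law mu (@word R d n) w = d.+1%:R ^- n.
Proof.
rewrite /law (_ : _ @^-1` _ = [set x : Om | forall i : 'I_n, x i \in [set w i]%SET]).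
  rewrite mu_prod /=; under eq_bigr do rewrite cards1 mul1r.
  by rewrite prodr_const card_ord exprVn.
apply/seteqP; split=> x /=.
  by move=> <- i; rewrite inE wordE.
by move=> h; apply/ffunP => i; have := h i; rewrite inE wordE => /eqP.
Qed.

Lemma uniform_word_shift n (w : {ffun 'I_n -> 'I_d.+1}) :
  law mu (@word R d n \o sh) w = d.+1%:R ^- n.
Proof.
pose B (i : 'I_n.+1) : {set 'I_d.+1} :=
  if unlift ord0 i is Some i' then [set w i']%SET else [set: 'I_d.+1]%SET.
rewrite /law (_ : _ @^-1` _ = [set x : Om | forall i : 'I_n.+1, x i \in B i]).
  rewrite mu_prod /= big_ord_recl /= {1}/B unlift_none cardsT card_ord.
  rewrite divff ?mul1r ?pnatr_eq0 //.
  under eq_bigr do rewrite /B liftK cards1 mul1r.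
  by rewrite prodr_const card_ord exprVn.
apply/seteqP; split=> x /=.
  move=> xw i; rewrite /B; case: unliftP => [i' ->|_]; last by rewrite inE.
  by rewrite inE -xw wordE.
move=> h; apply/ffunP => i; have := h (lift ord0 i).
by rewrite /B liftK inE wordE => /eqP.
Qed.

(** By uniqueness of measures it suffices to compare on sets determined by k
    letters, which are finite unions of cylinders. *)
Lemma uniform_product_invariant : invariant_probabilities sh mu.
Proof.
have [P PE] : exists P : {measure set BOm -> \bar R}, forall B, P B = mu (sh @^-1` B).
  by unshelve eexists (pushforward mu sh); [exact: measurable_shift_map|].
move=> B mB; rewrite -PE.
have setIG : setI_closed (@cylinder_sets R d).
  move=> C E [KC dC] [KE dE]; exists (maxn KC KE); apply: determinedI.
    by apply: determined_le dC; exact: leq_maxl.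
  by apply: determined_le dE; exact: leq_maxr.
apply: (@measure_unique _ R BOm (@cylinder_sets R d) (fun=> setT)
    borel_cylinder_sets setIG _ _ P mu) => //.
- by move=> _; exists 0%N.
- by apply/seteqP; split=> // x _; exists 0%N.
- move=> C [k dC].
  have CE (x : Om) : C x <-> `[< C (extend (@word R d k x)) >].
    have ag := @agree_extend R d k x.
    by split=> [Cx|/asboolP]; [apply/asboolP; apply: dC Cx; exact: agree_sym|exact: dC].
  have mC := determined_measurable dC.
  have mTC : measurable (sh @^-1` C).
    by rewrite -[_ @^-1` _]setTI; exact: measurable_shift_map.
  rewrite PE -fine_probability // -[RHS]fine_probability //; congr EFin.
  have fw := @finite_valued_word R d k.
  pose p (w : {ffun 'I_k -> 'I_d.+1}) := `[< C (extend w) >].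
  rewrite (_ : sh @^-1` C = [set x : BOm | p ((@word R d k \o sh) x)]); last first.
    by apply/seteqP; split=> x /= /CE.
  rewrite (_ : C = [set x : BOm | p (@word R d k x)]); last first.
    by apply/seteqP; split=> x /= /CE.
  rewrite !law_pred //; last exact: (finite_valued_measurable measurable_shift_map fw).
  by apply: eq_bigr => w _; rewrite uniform_word_shift uniform_word.
- by move=> _; rewrite PE preimage_setT probability_setT ltry.
Qed.

End uniform_measure.

Section block_code.
Context {R : realType} {d : nat}.
Local Notation Om := (fullshift R d).
Local Notation BOm := (borel_fullshift R d).
Local Notation sh := (@shift_map R d : BOm -> BOm).
Context {n j : nat} (code : {ffun 'I_j -> 'I_d.+1} -> {ffun 'I_n -> 'I_d.+1}).
Hypothesis n0 : (0 < n)%N.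
Hypothesis code_inj : injective code.

(** Cuts x into blocks of length j and replaces each by its code, a block of
    length n. *)
Definition block_code (x : Om) : Om := fun k =>
  code (@word R d j (iter (k %/ n * j) sh x)) (Ordinal (ltn_pmod k n0)).

Lemma block_codeE x b t (tn : (t < n)%N) :
  block_code x (b * n + t)%N = code (@word R d j (iter (b * j) sh x)) (Ordinal tn).
Proof.
rewrite /block_code divnMDl // divn_small // addn0; congr (code _ _).
by apply/val_inj; rewrite /= modnMDl modn_small.
Qed.

Lemma word_block_code x b :
  @word R d n (iter (b * n) sh (block_code x)) = code (@word R d j (iter (b * j) sh x)).
Proof.
apply/ffunP => t; rewrite wordE iter_shift_map.
case: t => t tn /=; exact: block_codeE.
Qed.

(** One output block corresponds to one input block; this is why averaging over n
    phases yields a shift-invariant probability. *)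
Lemma iter_block_code x : iter n sh (block_code x) = block_code (iter j sh x).
Proof.
apply/funext => k; rewrite iter_shift_map /block_code.
rewrite -[X in (X + k)%N]mul1n divnMDl // -iterD mulnDl mul1n addnC; congr (code _ _).
by apply/val_inj; rewrite /= mul1n modnDl.
Qed.

Lemma measurable_block_code : measurable_fun setT (block_code : BOm -> BOm).
Proof.
apply: measurable_fun_determined => K; exists (K * j)%N => x y xy k kK.
rewrite /block_code; congr (code _ _); apply/word_agree.
apply: agree_iter_shift; apply: agree_le xy.
by rewrite -mulSnr leq_mul2r (leq_ltn_trans (leq_div k n) kK) orbT.
Qed.

(** A window of length N n starting inside the first block contains the blocks of
    numbers 1, ..., N - 1 entirely, and injectivity recovers the input blocks. *)
Lemma block_code_separates N k x y : (0 < N)%N -> (k < n)%N ->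
  @word R d (N * n) (iter k sh (block_code x)) = @word R d (N * n) (iter k sh (block_code y)) ->
  @word R d (N.-1 * j) (iter j sh x) = @word R d (N.-1 * j) (iter j sh y).
Proof.
move=> N0 kn /word_agree xy; apply/word_agree => i iN.
have j0 : (0 < j)%N by case: (j) iN => //; rewrite muln0.
pose b := (i %/ j).+1.
have bN : (b < N)%N by rewrite /b -[N]prednK // ltnS ltn_divLR.
have : @word R d j (iter (b * j) sh x) = @word R d j (iter (b * j) sh y).
  apply: code_inj; rewrite -!word_block_code; apply/word_agree => t tn.
  rewrite !iter_shift_map.
  have kb : (k <= b * n + t)%N.
    by apply: leq_trans (leq_addr _ _); apply: leq_trans (ltnW kn) _; rewrite leq_pmull.
  have lt : (b * n + t - k < N * n)%N.
    apply: leq_ltn_trans (leq_subr _ _) _; apply: (@leq_trans (b.+1 * n)).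
      by rewrite mulSnr ltn_add2l.
    by rewrite leq_mul2r bN orbT.
  by have := xy _ lt; rewrite !iter_shift_map subnKC.
move/word_agree => /(_ (i %% j)%N (ltn_pmod i j0)); rewrite !iter_shift_map.
by rewrite /b mulSn -addnA -divn_eq.
Qed.

Variable mu : probability BOm R.
Hypothesis mu_prod : uniform_product mu.

(** The average over the phases k < n of the laws of the shifted coded sequences.
    Its words of length N n have small probability because each of them determines
    (N - 1) j letters of the uniform input. *)
Lemma exists_block_code_probability : exists rho : probability BOm R,
  [/\ invariant_probabilities sh rho,
      forall B, measurable B -> (forall k x, (k < n)%N -> B (iter k sh (block_code x))) ->
        fine (rho B) = 1 &
      forall N u, (0 < N)%N -> law rho (@word R d (N * n)) u <= d.+1%:R ^- (N.-1 * j)].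
Proof.
have mf k : measurable_fun setT (iter k sh \o block_code : BOm -> BOm).
  apply: measurableT_comp; last exact: measurable_block_code.
  exact: (measurable_iter measurable_shift_map).
have [rho rhoE] := average_probability mu n0 mf.
have mpre k B : measurable B -> measurable ((iter k sh \o block_code) @^-1` B : set BOm).
  by move=> mB; rewrite -[_ @^-1` _]setTI; exact: mf.
have nR : n%:R != 0 :> R by rewrite pnatr_eq0 -lt0n.
have muT := uniform_product_invariant mu_prod.
have mT := @measurable_shift_map R d.
have mI := measurable_iter mT.
exists rho; split.
- move=> B mB.
  have mTB : measurable (sh @^-1` B) by rewrite -[_ @^-1` _]setTI; exact: mT.
  rewrite -fine_probability // -[RHS]fine_probability // !rhoE //; congr EFin.
  congr (_ * _).
  (* shifting moves phase k to k + 1, and phase n has the same law as phase 0 *)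
  pose g k := fine (mu ((iter k sh \o block_code) @^-1` B)).
  rewrite (eq_bigr (fun k : 'I_n => g k.+1)) //.
  apply: (@addrI _ (g 0%N)).
  rewrite -(big_ord_recl n (fun k => g k)) big_ord_recr /= addrC; congr (_ + _).
  rewrite /g.
  have -> : (iter n sh \o block_code) @^-1` B = iter j sh @^-1` (block_code @^-1` B).
    by apply/seteqP; split=> x /=; rewrite iter_block_code.
  by rewrite (invariant_iter mT muT) //; exact: (mpre 0%N).
- move=> B mB Ball; rewrite rhoE // (eq_bigr (fun=> 1)).
    by rewrite sumr_const card_ord mulVf.
  move=> k _; rewrite (_ : _ @^-1` _ = setT) ?probability_setT //.
  by apply/seteqP; split=> // x _; exact: Ball.
- move=> N u N0; rewrite /law rhoE; last exact: finite_valued_word.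
  set c := d.+1%:R ^- _.
  have c0 : 0 <= c :> R by rewrite invr_ge0 exprn_ge0.
  rewrite ler_pdivrMl ?ltr0n //.
  apply: (@le_trans _ _ (\sum_(k < n) c)); last by rewrite sumr_const card_ord mulr_natl.
  apply: ler_sum => k _; set E := _ @^-1` _.
  have mE : measurable E by apply: (mpre k); exact: finite_valued_word.
  have [->|/set0P[x0 Ex0]] := eqVneq E set0; first by rewrite measure0.
  pose v := @word R d (N.-1 * j) (iter j sh x0).
  have fw := @finite_valued_word R d (N.-1 * j).
  have <- : law mu (@word R d (N.-1 * j) \o iter j sh) v = c.
    by rewrite (law_iter mT muT) // uniform_word.
  apply: fine_probability_le => //.
    exact: (finite_valued_measurable (mI j) fw).
  move=> x Ex; apply: block_code_separates N0 (ltn_ord k) _.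
  by move: Ex Ex0; rewrite /E /= => -> ->.
Qed.

End block_code.

(** * The pressure and the two functionals *)

Section variational_principle.
Context {R : realType} {d : nat} (A : fullshift R d -> R) (s : bool) (beta K C : R).
Local Notation Om := (fullshift R d).
Local Notation BOm := (borel_fullshift R d).
Local Notation sh := (@shift_map R d : BOm -> BOm).
Local Notation F := (quadratic s beta).
Local Notation mean := (birkhoff_mean (@shift_map R d) A).
Local Notation bsum := (birkhoff_sum (@shift_map R d) A).
Hypothesis beta0 : 0 <= beta.
Hypothesis K0 : 0 <= K.
Hypothesis AK : forall x, `|A x| <= K.
Hypothesis C0 : 0 <= C.
Hypothesis AC : forall n x y, agree n x y -> `|bsum n x - bsum n y| <= C.
Hypothesis bA : bounded_measurable (A : BOm -> R).
Variable mu : probability BOm R.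
Hypothesis mu_prod : uniform_product mu.
Let mT := @measurable_shift_map R d.
Let fl := @finite_valued_first_letter R d.

Lemma mean_bound n x : `|mean n x| <= K.
Proof.
have [->|n0] := posnP n; first by rewrite birkhoff_meanE invr0 mul0r normr0.
rewrite birkhoff_meanE normrM ger0_norm ?invr_ge0 // ler_pdivrMl ?ltr0n //.
exact: birkhoff_sum_bound.
Qed.

Lemma mean_agree n x y : agree n x y -> `|mean n x - mean n y| <= n%:R^-1 * C.
Proof.
move=> xy; rewrite !birkhoff_meanE -mulrBr normrM ger0_norm ?invr_ge0 //.
by rewrite ler_wpM2l ?invr_ge0 // AC.
Qed.

(** n F (A_n) varies by O (1) on a cylinder of length n, because A_n varies by
    O (1 / n) and F is Lipschitz on [-K, K]. *)
Lemma energy_agree n x y : agree n x y ->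
  `|n%:R * F (mean n x) - n%:R * F (mean n y)| <= beta * K * C.
Proof.
move=> xy; have [->|n0] := posnP n.
  by rewrite !mul0r subrr normr0 mulr_ge0 // mulr_ge0.
rewrite -mulrBr normrM ger0_norm // -ler_pdivlMl ?ltr0n //.
apply: le_trans (quadratic_dist s beta0 (mean_bound n x) (mean_bound n y)) _.
rewrite [leRHS]mulrCA ler_wpM2l ?mulr_ge0 //; exact: mean_agree.
Qed.

Definition word_energy n (w : {ffun 'I_n -> 'I_d.+1}) : R :=
  n%:R * F (mean n (extend w)).

Lemma word_energy_dist n x :
  `|n%:R * F (mean n x) - word_energy (@word R d n x)| <= beta * K * C.
Proof. by apply: energy_agree; apply: agree_sym; exact: agree_extend. Qed.

Definition partition_function n : R :=
  \sum_(w : {ffun 'I_n -> 'I_d.+1}) expR (word_energy w).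

Lemma bounded_measurable_energy n :
  bounded_measurable (fun x : BOm => n%:R * F (mean n x)).
Proof.
do 2 apply: bounded_measurableZ.
rewrite (_ : (fun _ => _) = fun x => 2^-1 * (beta * mean n x ^+ 2)); last first.
  by apply/funext => x; rewrite mulrC.
do 2 apply: bounded_measurableZ.
apply: bounded_measurable_sqr.
exact: (bounded_measurable_birkhoff_mean measurable_shift_map bA).
Qed.

Lemma partition_function_gt0 n : 0 < partition_function n.
Proof.
rewrite /partition_function (bigD1 [ffun=> ord0]) //= ltr_wpDr ?expR_gt0 //.
by rewrite sumr_ge0 // => *; exact: expR_ge0.
Qed.

(** On each word the integrand is exp (word_energy) up to the factor
    exp (beta K C), and mu charges all words equally. *)
Lemma pressure_seq_dist n : (0 < n)%N ->
  `|pressure_seq A mu F n - (n%:R^-1 * ln (partition_function n) - ln d.+1%:R)|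
  <= n%:R^-1 * (beta * K * C).
Proof.
move=> n0; have nR : 0 < n%:R :> R by rewrite ltr0n.
set D := beta * K * C.
have [mE [L EL]] := bounded_measurable_energy n.
have bexp : bounded_measurable (fun x : BOm => expR (n%:R * F (mean n x))).
  split; first exact: measurableT_comp.
  exists (expR L) => x; rewrite ger0_norm ?expR_ge0 // ler_expR.
  by apply: le_trans (EL x); exact: ler_norm.
have bw c : bounded_measurable (fun x : BOm => expR (c + word_energy (@word R d n x))).
  exact: (bounded_measurable_finite (fun w => expR (c + word_energy w)) (@finite_valued_word R d n)).
have Iw c : \int[mu]_x expR (c + word_energy (@word R d n x)) =
    expR c * (d.+1%:R ^- n * partition_function n).
  rewrite (Rintegral_finite_valued mu (fun w => expR (c + word_energy w)) (@finite_valued_word R d n)).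
  rewrite /partition_function !mulr_sumr; apply: eq_bigr => w _.
  by rewrite (uniform_word mu_prod) expRD mulrCA.
set I := \int[mu]_x expR (n%:R * F (mean n x)).
have Z0 := partition_function_gt0 n.
have D0 : 0 < d.+1%:R ^- n :> R by rewrite invr_gt0 exprn_gt0 // ltr0n.
have lnE c : ln (expR c * (d.+1%:R ^- n * partition_function n)) =
    c - n%:R * ln d.+1%:R + ln (partition_function n).
  rewrite lnM ?posrE ?expR_gt0 ?mulr_gt0 // expRK lnM ?posrE // lnV ?posrE ?exprn_gt0 ?ltr0n //.
  by rewrite lnXn ?ltr0n // mulr_natl addrA.
have I0 : expR (- D) * (d.+1%:R ^- n * partition_function n) <= I.
  rewrite -Iw; apply: le_Rintegral_bounded => // x; rewrite ler_expR.
  by have := word_energy_dist n x; rewrite ler_norml => /andP[+ _]; rewrite -/D; lra.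
have I1 : I <= expR D * (d.+1%:R ^- n * partition_function n).
  rewrite -Iw; apply: le_Rintegral_bounded => // x; rewrite ler_expR.
  by have := word_energy_dist n x; rewrite ler_norml => /andP[_ +]; rewrite -/D; lra.
have Igt : 0 < I by apply: lt_le_trans I0; rewrite mulr_gt0 ?expR_gt0 ?mulr_gt0.
have L0 : - D - n%:R * ln d.+1%:R + ln (partition_function n) <= ln I.
  by rewrite -lnE ler_ln ?posrE // mulr_gt0 ?expR_gt0 ?mulr_gt0.
have L1 : ln I <= D - n%:R * ln d.+1%:R + ln (partition_function n).
  by rewrite -lnE ler_ln ?posrE // mulr_gt0 ?expR_gt0 ?mulr_gt0.
have -> : pressure_seq A mu F n - (n%:R^-1 * ln (partition_function n) - ln d.+1%:R) =
    n%:R^-1 * (ln I - (ln (partition_function n) - n%:R * ln d.+1%:R)).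
  by rewrite /pressure_seq -/I !mulrBr mulKf ?gt_eqF.
rewrite normrM ger0_norm ?invr_ge0 // ler_wpM2l ?invr_ge0 // ler_norml.
by apply/andP; split; lra.
Qed.

Section with_rho.
Variable rho : probability BOm R.
Hypothesis rhoT : invariant_probabilities sh rho.
Local Notation H := (block_entropy (T := sh) (rho := rho) (@first_letter R d)).

(** The Gibbs inequality for the law of the first n letters under rho. *)
Lemma pressure_seq_ge_moment n : (0 < n)%N ->
  n%:R^-1 * H n + (-1) ^+ s * (beta / 2) * \int[rho]_x (mean n x ^+ 2) - ln d.+1%:R
   - n%:R^-1 * (2 * (beta * K * C)) <= pressure_seq A mu F n.
Proof.
move=> n0; have nR : 0 < n%:R :> R by rewrite ltr0n.
have fw := @finite_valued_word R d n.
have := @gibbs_variational _ _ (law rho (@word R d n)) (@word_energy n)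
  (fun w => law_ge0 rho (@word R d n) w) (law_sum1 rho fw).
rewrite -(Rintegral_finite_valued rho _ fw) -/(H n) -/(partition_function n).
have bE := bounded_measurable_energy n.
have bW := bounded_measurable_finite (@word_energy n) fw.
have := Rintegral_dist_le rho bE bW (word_energy_dist n).
have -> : \int[rho]_x (n%:R * F (mean n x)) =
    n%:R * ((-1) ^+ s * (beta / 2) * \int[rho]_x (mean n x ^+ 2)).
  rewrite -Rintegral_boundedZl; last first.
    apply: bounded_measurable_sqr.
    exact: (bounded_measurable_birkhoff_mean measurable_shift_map bA).
  rewrite -Rintegral_boundedZl; last first.
    apply: bounded_measurableZ; apply: bounded_measurable_sqr.
    exact: (bounded_measurable_birkhoff_mean measurable_shift_map bA).
  by apply: eq_Rintegral => x _; rewrite /quadratic; field.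
have := pressure_seq_dist n0.
move: (pressure_seq A mu F n) (partition_function n) (\int[rho]_x word_energy (@word R d n x))
  ((-1) ^+ s * (beta / 2) * \int[rho]_x (mean n x ^+ 2)) => p Z W m.
rewrite !ler_norml => /andP[h1 _] /andP[_ h2] h3.
have h4 : n%:R^-1 * (H n + (n%:R * m - beta * K * C)) <= n%:R^-1 * ln Z.
  by rewrite ler_wpM2l ?invr_ge0 //; lra.
have h5 : n%:R^-1 * (H n + (n%:R * m - beta * K * C)) =
    n%:R^-1 * H n + m - n%:R^-1 * (beta * K * C).
  by field; rewrite gt_eqF.
by rewrite mulrCA; lra.
Qed.

(** The Gibbs inequality for words of length n = M N + r made of M independent blocks
    with the law of the N-blocks under rho, completed arbitrarily.  Their entropy is
    M times that of one block, and S_n is a sum of M independent terms up to C per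
    block and K N for the tail, hence has mean close to n times the mean of A and
    variance O (n). *)
Lemma pressure_seq_ge_mean N n : (0 < N)%N -> (0 < n)%N ->
  N%:R^-1 * H N + F (\int[rho]_x A x) - ln d.+1%:R - N%:R^-1 * (2 * (beta * K * C))
   - n%:R^-1 * (beta * K * C + H N + 3 * (beta * K * K * N%:R))
  <= pressure_seq A mu F n.
Proof.
move=> N0 n0; have nR : 0 < n%:R :> R by rewrite ltr0n.
have NR : 0 < N%:R :> R by rewrite ltr0n.
pose M := (n %/ N)%N.
have MNn : (M * N <= n)%N by exact: leq_divM.
have nMN : (n < M.+1 * N)%N by exact: ltn_ceil.
pose W := {ffun 'I_N -> 'I_d.+1}.
(* concatenation of M blocks, completed by the letter 0 *)
pose join (f : {ffun 'I_M -> W}) : {ffun 'I_n -> 'I_d.+1} :=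
  [ffun k : 'I_n => if insub (k %/ N)%N is Some i then f i (Ordinal (ltn_pmod k N0)) else ord0].
pose y f : Om := extend (join f).
have yE f (i : 'I_M) : agree N (iter (i * N) (@shift_map R d) (y f)) (extend (f i)).
  move=> j jN; rewrite iter_shift_map /y.
  have lt : (i * N + j < n)%N.
    apply: leq_trans MNn; apply: (@leq_trans (i.+1 * N)); first by rewrite mulSnr ltn_add2l.
    by rewrite leq_mul2r ltn_ord orbT.
  have := congr1 (fun g : {ffun 'I_n -> 'I_d.+1} => g (Ordinal lt)) (@word_extend R d n (join f)).
  rewrite wordE /= => ->; rewrite ffunE /= divnMDl // divn_small // addn0 valK.
  have := congr1 (fun g : W => g (Ordinal jN)) (@word_extend R d N (f i)).
  rewrite wordE /= => ->; congr (f i _); apply/val_inj => /=.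
  by rewrite modnMDl modn_small.
have join_inj : injective join.
  move=> f g fg; apply/ffunP => i.
  rewrite -[f i](@word_extend R d) -[g i](@word_extend R d).
  apply/word_agree => j jN; rewrite -(yE f i j jN) -(yE g i j jN).
  by rewrite /y fg.
have fw := @finite_valued_word R d N.
pose p : W -> R := law rho (@word R d N).
have p0 w : 0 <= p w by exact: law_ge0.
have p1 : \sum_w p w = 1 by exact: law_sum1.
pose Y (w : W) : R := bsum N (extend w).
have YK w : `|Y w| <= N%:R * K by exact: birkhoff_sum_bound.
pose Z (f : {ffun 'I_M -> W}) : R := n%:R^-1 * \sum_i Y (f i).
pose EY := \sum_w p w * Y w.
pose m := n%:R^-1 * (M%:R * EY).
pose a := \int[rho]_x A x.
have MNR : M%:R * N%:R <= n%:R :> R by rewrite -natrM ler_nat.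
have nMNR : n%:R <= M%:R * N%:R + N%:R :> R by rewrite -natrM -natrD ler_nat addnC -mulSn ltnW.
have M0 : 0 <= M%:R :> R by [].
have EYa : `|EY - N%:R * a| <= C.
  rewrite /EY -(Rintegral_finite_valued rho Y fw) distrC.
  rewrite -(Rintegral_birkhoff_sum measurable_shift_map rhoT bA).
  apply: Rintegral_dist_le.
  - exact: (bounded_measurable_birkhoff_sum measurable_shift_map bA).
  - exact: bounded_measurable_finite.
  - by move=> x; apply: AC; apply: agree_sym; exact: agree_extend.
have aK : `|a| <= K.
  have := @Rintegral_dist_le _ _ _ rho A (fun=> 0) K bA (bounded_measurable_cst 0).
  rewrite Rintegral_probability_cst subr0; apply => x; by rewrite subr0.
have EYK : `|EY| <= N%:R * K.
  apply: le_trans (ler_norm_sum _ _ _) _.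
  under eq_bigr => w _ do rewrite normrM (ger0_norm (p0 w)).
  exact: convex_sum_le.
have mK : `|m| <= K.
  rewrite /m normrM ger0_norm ?invr_ge0 // ler_pdivrMl // normrM ger0_norm //.
  apply: (@le_trans _ _ (M%:R * (N%:R * K))); first by rewrite ler_wpM2l.
  by rewrite mulrA ler_wpM2r.
have ZK f : `|Z f| <= K.
  rewrite /Z normrM ger0_norm ?invr_ge0 // ler_pdivrMl //.
  apply: (@le_trans _ _ (M%:R * (N%:R * K))); last by rewrite mulrA ler_wpM2r.
  apply: le_trans (ler_norm_sum _ _ _) _.
  by rewrite mulr_natl -[M in _ *+ M]card_ord -sumr_const; apply: ler_sum.
have mean_y f : `|mean n (y f) - Z f| <= n%:R^-1 * (M%:R * C + N%:R * K).
  rewrite birkhoff_meanE /Z -mulrBr normrM ger0_norm ?invr_ge0 // ler_wpM2l ?invr_ge0 //.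
  have -> : bsum n (y f) = bsum (M * N + (n - M * N)) (y f) by rewrite subnKC.
  rewrite birkhoff_sumD birkhoff_sumM addrAC -sumrB.
  apply: le_trans (ler_normD _ _) _; apply: lerD.
    apply: le_trans (ler_norm_sum _ _ _) _.
    rewrite mulr_natl -[M in _ *+ M]card_ord -sumr_const; apply: ler_sum => i _.
    exact: AC.
  apply: le_trans (birkhoff_sum_bound _ _ _ AK) _; rewrite ler_wpM2r // ler_nat.
  by rewrite leq_subLR addnC -mulSn ltnW.
have energy_y f : n%:R * F (Z f) - beta * K * (M%:R * C + N%:R * K) <= word_energy (join f).
  have := quadratic_dist s beta0 (mean_bound n (y f)) (ZK f).
  rewrite ler_norml => /andP[h _].
  have h2 : beta * K * `|mean n (y f) - Z f| <= beta * K * (n%:R^-1 * (M%:R * C + N%:R * K)).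
    by rewrite ler_wpM2l ?mulr_ge0.
  have h3 : n%:R * (F (Z f) - beta * K * (n%:R^-1 * (M%:R * C + N%:R * K))) <= n%:R * F (mean n (y f)).
    by rewrite ler_wpM2l //; lra.
  apply: le_trans h3; rewrite mulrBr lerD2l lerN2 le_eqVlt; apply/orP; left; apply/eqP.
  by field; rewrite gt_eqF.
pose nu := prod_dist p (M := M).
have nu0 f : 0 <= nu f by exact: prod_dist_ge0.
have nu1 : \sum_f nu f = 1 by exact: prod_dist_sum1.
have nuZ : \sum_f nu f * Z f = m.
  rewrite /Z /m -(prod_dist_expectation_sum M p1) mulr_sumr; apply: eq_bigr => f _.
  by rewrite mulrCA.
have var : \sum_f nu f * (Z f - m) ^+ 2 <= n%:R^-1 * (K * K * N%:R).
  have E f : nu f * (Z f - m) ^+ 2 = n%:R^-1 ^+ 2 * (nu f * (\sum_i (Y (f i) - EY)) ^+ 2).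
    by rewrite sumrB sumr_const card_ord -[EY *+ M]mulr_natl /Z /m -mulrBr exprMn mulrCA.
  under eq_bigr do rewrite E.
  have cEY : \sum_w p w * (Y w - EY) = 0.
    under eq_bigr do rewrite mulrBr.
    by rewrite sumrB -mulr_suml p1 mul1r subrr.
  rewrite -mulr_sumr (prod_dist_variance M p1 cEY).
  have V : \sum_w p w * (Y w - EY) ^+ 2 <= (N%:R * K) ^+ 2.
    apply: (@le_trans _ _ (\sum_w p w * Y w ^+ 2)).
      rewrite -subr_ge0 (_ : _ - _ = EY ^+ 2) ?sqr_ge0 // -sumrB.
      transitivity (\sum_w ((p w * Y w) * (2 * EY) - p w * EY ^+ 2)).
        by apply: eq_bigr => w _; ring.
      by rewrite sumrB -!mulr_suml p1 -/EY; ring.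
    apply: convex_sum_le => // w.
    by rewrite -[leLHS]ger0_norm ?sqr_ge0 // normrX ler_sqr ?nnegrE ?mulr_ge0.
  apply: (@le_trans _ _ (n%:R^-1 ^+ 2 * (M%:R * (N%:R * K) ^+ 2))).
    by rewrite ler_wpM2l ?exprn_ge0 ?invr_ge0 // ler_wpM2l.
  have -> : n%:R^-1 ^+ 2 * (M%:R * (N%:R * K) ^+ 2) =
      n%:R^-1 * ((n%:R^-1 * (M%:R * N%:R)) * (K * K * N%:R)) by ring.
  rewrite ler_wpM2l ?invr_ge0 // ler_piMl ?mulr_ge0 //.
  by rewrite ler_pdivrMl // mulr1.
have nuF : n%:R * F m - beta * (K * K * N%:R) <= \sum_f nu f * (n%:R * F (Z f)).
  under eq_bigr do rewrite mulrCA.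
  rewrite -mulr_sumr (quadratic_expectation s beta nu1 nuZ) mulrDr lerD2l.
  set V := \sum_f _.
  have V0 : 0 <= V by apply: sumr_ge0 => f _; rewrite mulr_ge0 ?sqr_ge0.
  have nV : n%:R * V <= K * K * N%:R by rewrite -ler_pdivlMl.
  have nV0 : 0 <= n%:R * V by rewrite mulr_ge0.
  have b1 : beta * (n%:R * V) <= beta * (K * K * N%:R) by rewrite ler_wpM2l.
  have b2 : 0 <= beta * (n%:R * V) by rewrite mulr_ge0.
  rewrite (_ : n%:R * _ = (-1) ^+ s * (beta * (n%:R * V)) / 2); last by field.
  by case: (s); rewrite ?expr0 ?expr1; lra.
have Fma : n%:R * F a - beta * K * (M%:R * C + N%:R * K) <= n%:R * F m.
  have := quadratic_dist s beta0 mK aK.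
  rewrite ler_norml => /andP[h _].
  have ma : `|m - a| <= n%:R^-1 * (M%:R * C + N%:R * K).
    have -> : m - a = n%:R^-1 * (M%:R * (EY - N%:R * a) + (M%:R * N%:R - n%:R) * a).
      by rewrite /m; field; rewrite gt_eqF.
    rewrite normrM ger0_norm ?invr_ge0 // ler_wpM2l ?invr_ge0 //.
    apply: le_trans (ler_normD _ _) _; rewrite !normrM ger0_norm //.
    apply: lerD; first by rewrite ler_wpM2l.
    apply: ler_pM => //; rewrite ler_norml; apply/andP; split; lra.
  have h2 : beta * K * `|m - a| <= beta * K * (n%:R^-1 * (M%:R * C + N%:R * K)).
    by rewrite ler_wpM2l ?mulr_ge0.
  have h3 : n%:R * (F a - beta * K * (n%:R^-1 * (M%:R * C + N%:R * K))) <= n%:R * F m.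
    by rewrite ler_wpM2l //; lra.
  apply: le_trans h3; rewrite mulrBr lerD2l lerN2 le_eqVlt; apply/orP; left; apply/eqP.
  by field; rewrite gt_eqF.
have HN0 : 0 <= H N.
  apply: block_entropy_ge0; first exact: measurable_shift_map.
  exact: finite_valued_first_letter.
have lnZ : M%:R * H N + \sum_f nu f * word_energy (join f) <= ln (partition_function n).
  have := @gibbs_variational _ _ nu (fun f => word_energy (join f)) nu0 nu1.
  rewrite (shannon_prod_dist M p0 p1) -/(H N) => h; apply: le_trans h _.
  rewrite ler_ln ?posrE ?partition_function_gt0 //; last first.
    rewrite (bigD1 [ffun=> [ffun=> ord0]]) //= ltr_wpDr ?expR_gt0 //.
    by rewrite sumr_ge0 // => *; exact: expR_ge0.
  rewrite /partition_function.
  rewrite -(big_imset (h := join) (A := predT) (fun w => expR (word_energy w))) /=; last first.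
    by move=> f g _ _; exact: join_inj.
  rewrite [leRHS](bigID (mem [set join f | f in predT]%SET)) /= lerDl.
  by rewrite sumr_ge0 // => *; exact: expR_ge0.
have nuE : \sum_f nu f * (n%:R * F (Z f)) - beta * K * (M%:R * C + N%:R * K) <=
    \sum_f nu f * word_energy (join f).
  have := @convex_sum_le R _ nu (fun f => n%:R * F (Z f) - word_energy (join f))
    (beta * K * (M%:R * C + N%:R * K)) nu0 nu1.
  have h f : n%:R * F (Z f) - word_energy (join f) <= beta * K * (M%:R * C + N%:R * K).
    by have := energy_y f; lra.
  by move=> /(_ h); under eq_bigr do rewrite mulrBr; rewrite sumrB; lra.
have MH : n%:R * (N%:R^-1 * H N) - H N <= M%:R * H N.
  rewrite lerBlDr -[X in _ + X]mul1r -mulrDl mulrA ler_wpM2r //.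
  by rewrite ler_pdivrMr // mulrDl mul1r.
have MC : M%:R * (beta * K * C) <= n%:R * (N%:R^-1 * (beta * K * C)).
  by rewrite [leRHS]mulrA ler_wpM2r ?mulr_ge0 // ler_pdivlMr.
have := pressure_seq_dist n0; rewrite ler_norml => /andP[h1 _].
have := lnZ.
rewrite -(ler_pM2l (_ : 0 < n%:R^-1)) ?invr_gt0 // => {lnZ}h2.
have : n%:R^-1 * (n%:R * (N%:R^-1 * H N) - H N + (n%:R * F a
   - 2 * (n%:R * (N%:R^-1 * (beta * K * C))) - 3 * (beta * K * K * N%:R)))
   <= n%:R^-1 * ln (partition_function n).
  apply: le_trans h2; rewrite ler_wpM2l ?invr_ge0 //.
  have : 0 <= beta * K * K * N%:R by rewrite !mulr_ge0.
  have E1 : beta * (K * K * N%:R) = beta * K * K * N%:R by ring.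
  have E2 : beta * K * (M%:R * C + N%:R * K) = M%:R * (beta * K * C) + beta * K * K * N%:R by ring.
  rewrite E1 in nuF; rewrite E2 in Fma nuE.
  lra.
have -> : n%:R^-1 * (n%:R * (N%:R^-1 * H N) - H N + (n%:R * F a
   - 2 * (n%:R * (N%:R^-1 * (beta * K * C))) - 3 * (beta * K * K * N%:R))) =
   N%:R^-1 * H N + F a - N%:R^-1 * (2 * (beta * K * C)) - n%:R^-1 * (H N + 3 * (beta * K * K * N%:R)).
  by field; rewrite !gt_eqF.
have -> : n%:R^-1 * (beta * K * C + H N + 3 * (beta * K * K * N%:R)) =
  n%:R^-1 * (beta * K * C) + n%:R^-1 * (H N + 3 * (beta * K * K * N%:R)) by ring.
rewrite -/a; lra.
Qed.

End with_rho.
(** Real-valued form of -f, in which the entropy is the rate of the first-letter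
    partition and Delta is half the limit of the second moments; likewise
    [mean_functional] for -g. *)
Definition moment_functional (rho : probability BOm R) : R :=
  (-1) ^+ s * (beta / 2) * limn (fun m => \int[rho]_x (mean m x ^+ 2))
  + cylinder_entropy rho - ln d.+1%:R.

Definition mean_functional (rho : probability BOm R) : R :=
  F (\int[rho]_x A x) + cylinder_entropy rho - ln d.+1%:R.

(** The sum over [k, k + m[ is that over the full blocks of [0, k + m[, plus an
    incomplete last block, minus the first k terms; the last two have length
    at most n. *)
Lemma mean_near_of_blocks n k m (a eta : R) (z : Om) : (0 < n)%N -> (k < n)%N -> (0 < m)%N ->
  `|a| <= K -> 0 <= eta -> (forall b, `|bsum n (iter (b * n) sh z) - n%:R * a| <= n%:R * eta + C) ->
  `|mean m (iter k sh z) - a| <= eta + n%:R^-1 * C + m%:R^-1 * (n%:R * eta + C + 4 * (K * n%:R)).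
Proof.
move=> n0 kn m0 aK eta0 zb.
have nR : 0 < n%:R :> R by rewrite ltr0n.
have mR : 0 < m%:R :> R by rewrite ltr0n.
have short r x : (r <= n)%N -> `|bsum r x - r%:R * a| <= 2 * (K * n%:R).
  move=> rn; apply: le_trans (ler_normB _ _) _.
  have rR : r%:R <= n%:R :> R by rewrite ler_nat.
  have h1 := birkhoff_sum_bound (@shift_map R d) r x AK.
  have h2 : `|r%:R * a| <= r%:R * K by rewrite normrM ger0_norm // ler_wpM2l.
  have h3 : r%:R * K <= K * n%:R by rewrite mulrC ler_wpM2l.
  by lra.
pose M := ((k + m) %/ n)%N; pose r := ((k + m) %% n)%N.
have E : (k + m)%N = (M * n + r)%N by exact: divn_eq.
have long : `|bsum (M * n) z - (M * n)%:R * a| <= M%:R * (n%:R * eta + C).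
  have -> : (M * n)%:R * a = \sum_(i < M) n%:R * a.
    by rewrite sumr_const card_ord natrM -mulrA mulr_natl.
  rewrite birkhoff_sumM -sumrB; apply: le_trans (ler_norm_sum _ _ _) _.
  apply: (@le_trans _ _ (\sum_(i < M) (n%:R * eta + C))); first exact: ler_sum.
  by rewrite sumr_const card_ord [M%:R * _]mulr_natl.
have S : bsum m (iter k sh z) - m%:R * a = (bsum (M * n) z - (M * n)%:R * a)
   + (bsum r (iter (M * n) sh z) - r%:R * a) - (bsum k z - k%:R * a).
  have h1 := birkhoff_sumD (@shift_map R d) A k m z.
  have h2 := birkhoff_sumD (@shift_map R d) A (M * n) r z.
  have h3 : k%:R + m%:R = (M * n)%:R + r%:R :> R by rewrite -!natrD E.
  rewrite E h2 in h1.
  have h4 : m%:R = (M * n)%:R + r%:R - k%:R :> R by lra.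
  have h5 : bsum m (iter k sh z) = bsum (M * n) z + bsum r (iter (M * n) sh z) - bsum k z.
    by rewrite h1 addrC addKr.
  by rewrite h5 h4; ring.
have Mm : M%:R * n%:R <= m%:R + n%:R :> R.
  rewrite -natrM -natrD ler_nat; apply: (@leq_trans (k + m)); first by rewrite E leq_addr.
  by rewrite addnC leq_add2l ltnW.
have P0 : 0 <= n%:R * eta + C by rewrite addr_ge0 // mulr_ge0.
have bound : `|bsum m (iter k sh z) - m%:R * a| <=
    (m%:R + n%:R) * (eta + n%:R^-1 * C) + 4 * (K * n%:R).
  have hr := short r (iter (M * n) sh z) (ltnW (ltn_pmod _ n0)).
  have hk := short k z (ltnW kn).
  have hl : M%:R * (n%:R * eta + C) <= (m%:R + n%:R) * (eta + n%:R^-1 * C).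
    have -> : M%:R * (n%:R * eta + C) = (M%:R * n%:R) * (eta + n%:R^-1 * C).
      by field; rewrite gt_eqF.
    by rewrite ler_wpM2r // addr_ge0 // mulr_ge0 // invr_ge0.
  rewrite S; apply: le_trans (ler_normB _ _) _.
  have := ler_normD (bsum (M * n) z - (M * n)%:R * a) (bsum r (iter (M * n) sh z) - r%:R * a).
  lra.
have -> : mean m (iter k sh z) - a = m%:R^-1 * (bsum m (iter k sh z) - m%:R * a).
  by rewrite birkhoff_meanE mulrBr mulKf ?gt_eqF.
rewrite normrM ger0_norm ?invr_ge0 // ler_pdivrMl //; apply: le_trans bound _.
rewrite le_eqVlt; apply/orP; left; apply/eqP; field; by rewrite !gt_eqF.
Qed.

(** All orbits of the coded sequences are concatenations of elements of W, so their
    Birkhoff means are uniformly close to a; this yields at once the mean of A and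
    the second moments.  For the entropy, each word of length N n has probability
    at most D ^ - ((N - 1) j), with D the number of letters. *)
Lemma exists_probability_of_words n (W : {set {ffun 'I_n -> 'I_d.+1}}) j (a eta : R) :
  (0 < n)%N -> (d.+1 ^ j <= #|W|)%N -> `|a| <= K -> 0 <= eta ->
  (forall w, w \in W -> `|mean n (extend w) - a| <= eta) ->
  exists rho : probability BOm R,
    [/\ invariant_probabilities sh rho,
        n%:R^-1 * (j%:R * ln d.+1%:R) <= cylinder_entropy rho,
        `|\int[rho]_x A x - a| <= eta + n%:R^-1 * C &
        `|limn (fun m => \int[rho]_x (mean m x ^+ 2)) - a ^+ 2|
           <= 2 * K * (eta + n%:R^-1 * C)].
Proof.
move=> n0 jW aK eta0 Wa.
have cardj : (#|{ffun 'I_j -> 'I_d.+1}| <= #|W|)%N by rewrite card_ffun !card_ord.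
pose code (v : {ffun 'I_j -> 'I_d.+1}) : {ffun 'I_n -> 'I_d.+1} :=
  enum_val (widen_ord cardj (enum_rank v)).
have codeW v : code v \in W by exact: enum_valP.
have code_inj : injective code.
  move=> u v /enum_val_inj /(congr1 val) /= uv.
  by apply: enum_rank_inj; exact: val_inj.
have [rho [rhoT full small]] := exists_block_code_probability n0 code_inj mu_prod.
have nR : 0 < n%:R :> R by rewrite ltr0n.
(* the constant of the O (1 / m) error in [mean_near_of_blocks] *)
pose B : R := n%:R * eta + C + 4 * (K * n%:R).
have dev0 m : 0 <= eta + n%:R^-1 * C + m%:R^-1 * B.
  by rewrite !addr_ge0 ?mulr_ge0 ?invr_ge0 ?addr_ge0 ?mulr_ge0.
have bmean m := bounded_measurable_birkhoff_mean mT bA m.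
have nearB m : (0 < m)%N -> forall k x, (k < n)%N ->
    `|mean m (iter k sh (block_code code n0 x)) - a| <= eta + n%:R^-1 * C + m%:R^-1 * B.
  move=> m0 k x kn; apply: mean_near_of_blocks => // b.
  have -> : bsum n (iter (b * n) sh (block_code code n0 x)) - n%:R * a =
      (bsum n (iter (b * n) sh (block_code code n0 x)) -
       bsum n (extend (code (@word R d j (iter (b * j) sh x))))) +
      n%:R * (mean n (extend (code (@word R d j (iter (b * j) sh x)))) - a).
    by rewrite birkhoff_meanE; field; rewrite gt_eqF.
  rewrite addrC; apply: le_trans (ler_normD _ _) _; apply: lerD.
    by rewrite normrM ger0_norm // ler_wpM2l // Wa.
  by apply: AC; rewrite -word_block_code; apply: agree_sym; exact: agree_extend.
have subK (f : R) c : `|f| <= c -> `|f - a| <= c + K.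
  by move=> fc; apply: le_trans (ler_normB _ _) (lerD _ _).
have mset (f : BOm -> R) (b c : R) : bounded_measurable f ->
    measurable [set x : BOm | `|f x - b| <= c].
  move=> bf; have [mfa _] := bounded_measurableD bf (bounded_measurable_cst (- b)).
  have := measurableT_comp (@normr_measurable R setT) mfa.
  move=> /(_ measurableT _ (@measurable_itv R `]-oo, c])).
  by rewrite setTI; congr (measurable _); apply/seteqP; split=> x /=; rewrite in_itv.
have int1 m : (0 < m)%N -> `|\int[rho]_x A x - a| <= eta + n%:R^-1 * C + m%:R^-1 * B.
  move=> m0; rewrite -(Rintegral_birkhoff_mean mT rhoT bA m0).
  apply: (@Rintegral_near_full _ _ _ rho _ _ _ (K + K)) => //.
    by move=> x; apply: subK; exact: mean_bound.
  apply: full; first exact: mset.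
  by move=> k x kn; exact: nearB.
have int2 m : (0 < m)%N -> `|\int[rho]_x (mean m x ^+ 2) - a ^+ 2| <=
    2 * K * (eta + n%:R^-1 * C + m%:R^-1 * B).
  move=> m0; have sq f : `|f| <= K -> `|f ^+ 2 - a ^+ 2| <= 2 * K * `|f - a|.
    move=> fK; rewrite subr_sqr normrM mulrC ler_wpM2r //.
    by apply: le_trans (ler_normD _ _) _; lra.
  apply: (@Rintegral_near_full _ _ _ rho _ _ _ (2 * K * (K + K))) => //.
  - exact: bounded_measurable_sqr.
  - move=> x; have mK := mean_bound m x.
    apply: le_trans (sq _ mK) _; rewrite ler_wpM2l ?mulr_ge0 //; exact: subK.
  - by rewrite !mulr_ge0.
  apply: full; first by apply: mset; exact: bounded_measurable_sqr.
  move=> k x kn /=; apply: le_trans (sq _ _) _; first exact: mean_bound.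
  by rewrite ler_wpM2l ?mulr_ge0 //; exact: nearB.
have slack (e : R) : 0 < e -> exists2 m, (0 < m)%N & m%:R^-1 * B <= e.
  move=> e0; have [N _ NP] := near_inv_le B e0.
  by exists N.+1 => //; apply: NP => /=.
exists rho; split=> //.
- have [cv _] := cvg_entropy_rate mT rhoT (@finite_valued_first_letter R d).
  apply/ler_addgt0Pr => e e0.
  have e2 : 0 < e / 2 by rewrite divr_gt0.
  have lt : cylinder_entropy rho < cylinder_entropy rho + e / 2 by rewrite ltrDl.
  have [N1 _ N1P] := cvgr_le _ cv _ lt.
  have [N2 _ N2P] := near_inv_le (n%:R^-1 * (j%:R * ln d.+1%:R)) e2.
  pose N := (maxn N1 N2).+1.
  have l2 : (N2 <= N)%N by rewrite ltnW // ltnS leq_maxr.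
  have l1 : (N1 <= N * n)%N.
    by apply: leq_trans (leq_pmulr _ n0); rewrite ltnW // ltnS leq_maxl.
  have := N1P (N * n)%N l1; have /= h2 := N2P N l2 => /=.
  set H := block_entropy _ _ => h1.
  have h3 : N.-1%:R * (j%:R * ln d.+1%:R) <= H.
    have fw := @finite_valued_word R d (N * n).
    have le u : 0 <= law rho (@word R d (N * n)) u <= d.+1%:R ^- (N.-1 * j).
      by rewrite law_ge0 small.
    have := shannon_ge le (law_sum1 rho fw).
    rewrite lnV ?posrE ?exprn_gt0 ?ltr0n // opprK lnXn ?ltr0n //.
    by rewrite -[ln _ *+ _]mulr_natl natrM mulrA.
  have NR : 0 < N%:R :> R by rewrite ltr0n.
  have h4 : (N * n)%:R^-1 * (N.-1%:R * (j%:R * ln d.+1%:R)) <= (N * n)%:R^-1 * H.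
    by rewrite ler_wpM2l ?invr_ge0.
  have h5 : (N * n)%:R^-1 * (N.-1%:R * (j%:R * ln d.+1%:R)) =
      n%:R^-1 * (j%:R * ln d.+1%:R) - N%:R^-1 * (n%:R^-1 * (j%:R * ln d.+1%:R)) :> R.
    have -> : N.-1%:R = N%:R - 1 :> R by rewrite /N -[in RHS]natr1 addrK.
    by rewrite natrM; field; rewrite !gt_eqF.
  lra.
- apply/ler_addgt0Pr => e e0; have [m m0 me] := slack e e0.
  by have := int1 m m0; lra.
have cv := cvg_Rintegral_birkhoff_sqr mT rhoT bA.
apply/ler_addgt0Pr => e e0.
have e2 : 0 < e / 2 by rewrite divr_gt0.
have [N1 _ N1P] := (cvgrPdist_le _ _).1 cv _ e2.
have [N2 _ N2P] := near_inv_le (2 * K * B) e2.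
pose m := (maxn N1 N2).+1.
have l2 : (N2 <= m)%N by rewrite ltnW // ltnS leq_maxr.
have l1 : (N1 <= m)%N by rewrite ltnW // ltnS leq_maxl.
have /= h1 := N1P m l1; have /= h2 := N2P m l2.
have h3 := int2 m (ltn0Sn _).
set L := limn _ in h1 *; set I := \int[rho]_x _ in h1 h3.
have := ler_normD (L - I) (I - a ^+ 2); rewrite addrA subrK.
have : 2 * K * (eta + n%:R^-1 * C + m%:R^-1 * B) =
  2 * K * (eta + n%:R^-1 * C) + m%:R^-1 * (2 * K * B) by ring.
lra.
Qed.

Lemma pressure_seq_near_ge_moment rho e : invariant_probabilities sh rho -> 0 < e ->
  \forall n \near \oo, moment_functional rho - e <= pressure_seq A mu F n.
Proof.
move=> rhoT e0; have e2 : 0 < e / 2 by rewrite divr_gt0.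
pose H := block_entropy (T := sh) (rho := rho) (@first_letter R d).
pose u n := n%:R^-1 * H n + (-1) ^+ s * (beta / 2) * \int[rho]_x (mean n x ^+ 2).
have [cH _] := cvg_entropy_rate mT rhoT fl.
have cM := cvg_Rintegral_birkhoff_sqr mT rhoT bA.
have cu : u @ \oo --> cylinder_entropy rho +
    (-1) ^+ s * (beta / 2) * limn (fun m => \int[rho]_x (mean m x ^+ 2)).
  by apply: cvgD => //; apply: cvgMl_tmp.
have lt : cylinder_entropy rho +
    (-1) ^+ s * (beta / 2) * limn (fun m => \int[rho]_x (mean m x ^+ 2)) - e / 2 <
    cylinder_entropy rho +
    (-1) ^+ s * (beta / 2) * limn (fun m => \int[rho]_x (mean m x ^+ 2)).
  by rewrite ltrBlDr ltrDl.
near=> n.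
have n0 : (0 < n)%N by near: n; exact: nbhs_infty_gt.
have h1 : cylinder_entropy rho +
    (-1) ^+ s * (beta / 2) * limn (fun m => \int[rho]_x (mean m x ^+ 2)) - e / 2 <= u n.
  by near: n; exact: (cvgr_ge _ cu).
have h2 : n%:R^-1 * (2 * (beta * K * C)) <= e / 2 by near: n; exact: near_inv_le.
have := pressure_seq_ge_moment rho n0.
rewrite -/(H n) /moment_functional; rewrite /u in h1; lra.
Unshelve. all: by end_near. Qed.

(** The entropy rate is at most the entropy of N-blocks divided by N; first N is
    taken large to absorb the distortion per block, then n. *)
Lemma pressure_seq_near_ge_mean rho e : invariant_probabilities sh rho -> 0 < e ->
  \forall n \near \oo, mean_functional rho - e <= pressure_seq A mu F n.
Proof.
move=> rhoT e0; have e2 : 0 < e / 2 by rewrite divr_gt0.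
pose H := block_entropy (T := sh) (rho := rho) (@first_letter R d).
have [_ Hinf] := cvg_entropy_rate mT rhoT fl.
have [N0 _ N0P] := near_inv_le (2 * (beta * K * C)) e2.
pose N := N0.+1; have /= hN := N0P N (leqnSn _).
have h3 := Hinf N (ltn0Sn _).
near=> n.
have n0 : (0 < n)%N by near: n; exact: nbhs_infty_gt.
have h2 : n%:R^-1 * (beta * K * C + H N + 3 * (beta * K * K * N%:R)) <= e / 2.
  by near: n; exact: near_inv_le.
have := pressure_seq_ge_mean (N := N) rhoT (ltn0Sn _) n0.
rewrite -/(H N) /mean_functional /cylinder_entropy; rewrite -/(H N) in h3; lra.
Unshelve. all: by end_near. Qed.

Lemma pressure_seq_bounded n : pressure_seq A mu F n <= beta * K * K + beta * K * C.
Proof.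
have [->|n0] := posnP n.
  by rewrite /pressure_seq invr0 mul0r addr_ge0 // !mulr_ge0.
have nR : 0 < n%:R :> R by rewrite ltr0n.
have := pressure_seq_dist n0.
rewrite ler_norml => /andP[_ h].
have Z : partition_function n <= d.+1%:R ^+ n * expR (n%:R * (beta * K * K)).
  rewrite /partition_function.
  apply: (@le_trans _ _ (\sum_(w : {ffun 'I_n -> 'I_d.+1}) expR (n%:R * (beta * K * K)))).
    apply: ler_sum => w _; rewrite ler_expR ler_wpM2l //.
    apply: le_trans (ler_norm _) _; apply: quadratic_le => //; exact: mean_bound.
  by rewrite sumr_const card_ffun !card_ord -[_ *+ _]mulr_natl natrX.
have Z0 := partition_function_gt0 n.
have : ln (partition_function n) <= n%:R * ln d.+1%:R + n%:R * (beta * K * K).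
  apply: le_trans (_ : _ <= ln (d.+1%:R ^+ n * expR (n%:R * (beta * K * K)))) _.
    by rewrite ler_ln ?posrE // mulr_gt0 ?expR_gt0 ?exprn_gt0 ?ltr0n.
  rewrite lnM ?posrE ?expR_gt0 ?exprn_gt0 ?ltr0n // expRK lnXn ?ltr0n //.
  by rewrite -[ln _ *+ _]mulr_natl.
rewrite -mulrDr -ler_pdivrMl // => h2.
have h3 : n%:R^-1 * (beta * K * C) <= beta * K * C.
  by rewrite ler_piMl ?mulr_ge0 // invf_le1 // ler1n.
lra.
Qed.

(** Bins of width eta and the pigeonhole principle give a set W of words with almost
    the same mean a and with log Z_n at most
    log #|W| + n (F a + beta K eta) + log B; both functionals of the probability
    built from W are close to log #|W| / n + F a - log D. *)
Lemma exists_near_optimal e : 0 < e -> \forall n \near \oo,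
  exists2 rho : probability BOm R, invariant_probabilities sh rho &
    pressure_seq A mu F n - e <= moment_functional rho /\
    pressure_seq A mu F n - e <= mean_functional rho.
Proof.
move=> e0; have e2 : 0 < e / 2 by rewrite divr_gt0.
have bK0 : 0 <= beta * K by rewrite mulr_ge0.
have bK1 : 0 < 4 * (beta * K + 1) by rewrite mulr_gt0 // ltr_wpDl.
(* the error 2 beta K eta, once for the bin and once for the measure, must be
   at most e / 2 *)
pose eta := e / (4 * (beta * K + 1)).
have eta0 : 0 < eta by rewrite divr_gt0.
have eta_small : 2 * (beta * K * eta) <= e / 2.
  rewrite (_ : 2 * _ = 2 * (beta * K) * e / (4 * (beta * K + 1))); last by rewrite /eta !mulrA.
  rewrite ler_pdivrMr // (_ : e / 2 * _ = 2 * (beta * K) * e + 2 * e); last by field.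
  by rewrite lerDl mulr_ge0 // ltW.
(* number of bins of width eta covering [-K, K]; it does not depend on n *)
pose B := (Num.truncn (2 * K / eta)).+1.
near=> n.
have n0 : (0 < n)%N by near: n; exact: nbhs_infty_gt.
have small : n%:R^-1 * (ln B%:R + ln d.+1%:R + 2 * (beta * K * C)) <= e / 2.
  by near: n; exact: near_inv_le.
have nR : 0 < n%:R :> R by rewrite ltr0n.
pose v (w : {ffun 'I_n -> 'I_d.+1}) := mean n (extend w).
have vK w : `|v w| <= K by exact: mean_bound.
pose bin w : 'I_B := inord (Num.truncn ((v w + K) / eta)).
have bin_close w w' : bin w = bin w' -> `|v w - v w'| <= eta.
  have pos u : 0 <= (v u + K) / eta.
    by rewrite divr_ge0 ?(ltW eta0) //; have := vK u; rewrite ler_norml => /andP[+ _]; lra.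
  have lt u : (Num.truncn ((v u + K) / eta) < B)%N.
    rewrite ltnS; apply: le_truncn; rewrite ler_wpM2r ?invr_ge0 ?(ltW eta0) //.
    by have := vK u; rewrite ler_norml => /andP[_]; lra.
  move=> /(congr1 val) /=; rewrite !inordK // => tt.
  have /andP[a1 a2] := truncn_itv (pos w); have /andP[b1 b2] := truncn_itv (pos w').
  have : `|(v w + K) / eta - (v w' + K) / eta| <= 1.
    move: a1 a2 b1 b2; rewrite tt -natr1 => a1 a2 b1 b2.
    by rewrite ler_norml; apply/andP; split; lra.
  rewrite -mulrBl normrM [`|eta^-1|]ger0_norm ?invr_ge0 ?(ltW eta0) // ler_pdivrMr // mul1r.
  by rewrite opprD addrACA subrr addr0.
have [b0 Zb] := @pigeonhole_sum R _ B bin (fun w => expR (word_energy w)) (ltn0Sn _).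
rewrite -/(partition_function n) in Zb.
pose W := [set w | bin w == b0]%SET.
have Z0 := partition_function_gt0 n.
have [w0 w0W] : exists w0, w0 \in W.
  apply/set0Pn; apply: contraTneq Z0 => W0; rewrite -leNgt; apply: le_trans Zb _.
  rewrite big_pred0 ?mulr0 // => w; have : w \notin W by rewrite W0 inE.
  by rewrite inE => /negbTE.
have W1 : (0 < #|W|)%N by rewrite card_gt0; apply/set0Pn; exists w0.
pose a := v w0.
have Wa w : w \in W -> `|v w - a| <= eta.
  move: w0W; rewrite !inE => /eqP b1 /eqP b2.
  by apply: bin_close; rewrite b1 b2.
have [j jW lnW] : exists2 j, (d.+1 ^ j <= #|W|)%N & ln #|W|%:R <= j.+1%:R * ln d.+1%:R :> R.
  apply: (exists_power_below R (n := n)) => //.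
  by apply: leq_trans (max_card _) _; rewrite card_ffun !card_ord.
have [rho [rhoT ent meanA momA]] :=
  exists_probability_of_words n0 jW (vK w0) (ltW eta0) Wa.
exists rho => //.
have D0 : 0 <= ln d.+1%:R :> R by rewrite ln_ge0 // ler1n.
have B1 : 0 < B%:R :> R by rewrite ltr0n.
have lnZ : ln (partition_function n) <=
    ln B%:R + ln #|W|%:R + n%:R * (F a + beta * K * eta).
  have ZW : partition_function n <=
      B%:R * (#|W|%:R * expR (n%:R * (F a + beta * K * eta))).
    apply: le_trans Zb _; rewrite ler_wpM2l //.
    apply: (@le_trans _ _ (\sum_(w in W) expR (n%:R * (F a + beta * K * eta)))).
      rewrite (eq_bigl (fun w => w \in W)); last by move=> w; rewrite inE.
      apply: ler_sum => w wW; rewrite ler_expR ler_wpM2l //.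
      have := quadratic_dist s beta0 (vK w) (vK w0).
      have : beta * K * `|v w - v w0| <= beta * K * eta by rewrite ler_wpM2l // Wa.
      by rewrite ler_norml -/a -/(v w) => h /andP[_]; lra.
    by rewrite sumr_const -[_ *+ _]mulr_natl.
  have W1R : 0 < #|W|%:R :> R by rewrite ltr0n.
  apply: (@le_trans _ _ (ln (B%:R * (#|W|%:R * expR (n%:R * (F a + beta * K * eta)))))).
    by rewrite ler_ln ?posrE // !mulr_gt0 ?expR_gt0.
  by rewrite !lnM ?posrE ?mulr_gt0 ?expR_gt0 // expRK addrA.
have := pressure_seq_dist n0.
rewrite ler_norml => /andP[_ hp].
have hZ : n%:R^-1 * ln (partition_function n) <=
    n%:R^-1 * (ln B%:R + ln d.+1%:R) + n%:R^-1 * (j%:R * ln d.+1%:R) + (F a + beta * K * eta).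
  have -> : n%:R^-1 * (ln B%:R + ln d.+1%:R) + n%:R^-1 * (j%:R * ln d.+1%:R) + (F a + beta * K * eta) =
     n%:R^-1 * (ln B%:R + j.+1%:R * ln d.+1%:R + n%:R * (F a + beta * K * eta)).
    by rewrite -[j.+1%:R]natr1; field; rewrite gt_eqF.
  by rewrite ler_wpM2l ?invr_ge0 //; lra.
have small' : n%:R^-1 * (ln B%:R + ln d.+1%:R) + n%:R^-1 * (beta * K * C) + n%:R^-1 * (beta * K * C) <= e / 2.
  by move: small; rewrite !mulrDr; lra.
have key (q : R) : F a - beta * K * (eta + n%:R^-1 * C) <= q ->
    pressure_seq A mu F n - e <= q + cylinder_entropy rho - ln d.+1%:R.
  have -> : beta * K * (eta + n%:R^-1 * C) = beta * K * eta + n%:R^-1 * (beta * K * C) by ring.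
  by lra.
have eC : 0 <= eta + n%:R^-1 * C by rewrite addr_ge0 ?(ltW eta0) // mulr_ge0 ?invr_ge0.
split; apply: key.
  set L := limn _ in momA *.
  have Fa : F a = (-1) ^+ s * (beta / 2) * a ^+ 2 by rewrite /quadratic; field.
  rewrite Fa lerBlDr -lerBlDl -mulrBr; apply: le_trans (ler_norm _) _.
  rewrite 2!normrM normrX normrN1 expr1n mul1r ger0_norm ?divr_ge0 // distrC.
  have -> : beta * K * (eta + n%:R^-1 * C) = beta / 2 * (2 * K * (eta + n%:R^-1 * C)).
    by field; rewrite gt_eqF.
  by rewrite ler_wpM2l ?divr_ge0.
have iK : `|\int[rho]_x A x| <= K.
  have := @Rintegral_dist_le _ _ _ rho A (fun=> 0) K bA (bounded_measurable_cst 0).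
  rewrite Rintegral_probability_cst subr0; apply => x; by rewrite subr0.
have := quadratic_dist s beta0 (vK w0) iK.
have : beta * K * `|v w0 - \int[rho]_x A x| <= beta * K * (eta + n%:R^-1 * C).
  by rewrite ler_wpM2l // distrC.
by rewrite ler_norml -/a => h /andP[_]; lra.
Unshelve. all: by end_near. Qed.

End variational_principle.

Lemma sup_functional_pressure (R : realType) (X : Type) (PT : set X) (fr : X -> \bar R)
    (g : X -> R) (p : R^nat) (M : R) :
  (forall rho, PT rho -> (fr rho = - (g rho)%:E)%E) ->
  (forall n, p n <= M) ->
  (forall rho e, PT rho -> 0 < e -> \forall n \near \oo, g rho - e <= p n) ->
  (forall e, 0 < e -> \forall n \near \oo, exists2 rho, PT rho & p n - e <= g rho) ->
  cvgn p /\ (- ereal_inf [set fr rho | rho in PT])%E = (limn p)%:E.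
Proof.
move=> frE pM lo up.
have [] := @sup_envelope_cvg R (g @` PT) p M pM.
- by move=> _ [rho PTrho <-] e e0; exact: lo.
- move=> e e0; have [N _ NP] := up e e0; exists N => // n /NP [rho PTrho h].
  by exists (g rho) => //; exists rho.
move=> supS cv.
split; first by apply/cvg_ex; eexists; exact: cv.
rewrite (cvg_lim _ cv) // -(ereal_sup_EFin supS.2 supS.1) ereal_infEN oppeK.
congr ereal_sup.
apply/seteqP; split=> [_ [_ [rho PTrho <-] <-]|_ [_ [rho PTrho <-] <-]] /=.
  by exists (g rho); [exists rho|rewrite frE // oppeK].
by exists (fr rho); [exists rho|rewrite frE // oppeK].
Qed.

Theorem theorem3p8 (R : realType) (d : nat)
    (mu : probability (borel_fullshift R d) R) (mu_prod : uniform_product mu)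
    (A : fullshift R d -> R) (A_hoelder : hoelder_continuous A)
    (beta : R) (beta_gt0 : 0 < beta) (s : bool) :
  let PT := invariant_probabilities (R := R) (X := borel_fullshift R d)
              (@shift_map R d) in
  [/\ (- ereal_inf [set frakf s beta A rho | rho in PT] =
       - ereal_inf [set frakg s beta A rho | rho in PT])%E,
      (- ereal_inf [set frakg s beta A rho | rho in PT])%E =
       (pressure A mu (quadratic s beta))%:E &
      cvgn (pressure_seq A mu (quadratic s beta))].
Proof.
move=> PT.
have [K K_gt0 AK] := hoelder_bound A_hoelder.
have [C C0 AC] := hoelder_distortion A_hoelder.
have bA := hoelder_bounded_measurable A_hoelder.
have b0 := ltW beta_gt0; have K0 := ltW K_gt0.
pose p := pressure_seq A mu (quadratic s beta).
have pM := @pressure_seq_bounded R d A s beta K C b0 K0 AK C0 AC bA mu mu_prod.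
have near_opt := @exists_near_optimal R d A s beta K C b0 K0 AK C0 AC bA mu mu_prod.
have fE rho : PT rho -> (frakf s beta A rho = - (moment_functional A s beta rho)%:E)%E.
  move=> rhoT; rewrite /frakf (ks_entropyE rhoT) -!EFinD -EFinN; congr (- _)%:E.
  congr (_ + _ - _); rewrite /Delta -mulrA; congr (_ * _).
  have cM := cvg_Rintegral_birkhoff_sqr (@measurable_shift_map R d) rhoT bA.
  have -> : limn (fun n => 2^-1 * \int[rho]_x (birkhoff_mean (@shift_map R d) A n x ^+ 2)) =
      2^-1 * limn (fun n => \int[rho]_x (birkhoff_mean (@shift_map R d) A n x ^+ 2)).
    by apply: cvg_lim => //; apply: cvgMl_tmp.
  by rewrite mulrA.
have gE rho : PT rho -> (frakg s beta A rho = - (mean_functional A s beta rho)%:E)%E.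
  move=> rhoT; rewrite /frakg (ks_entropyE rhoT) -!EFinD -EFinN; congr (- _)%:E.
  by congr (_ + _ - _); rewrite /quadratic; congr (_ * _); rewrite mulrAC.
have optf e : 0 < e -> \forall n \near \oo, exists2 rho, PT rho &
    p n - e <= moment_functional A s beta rho.
  by move=> /near_opt [N _ NP]; exists N => // n /NP [rho rhoT []]; exists rho.
have optg e : 0 < e -> \forall n \near \oo, exists2 rho, PT rho &
    p n - e <= mean_functional A s beta rho.
  by move=> /near_opt [N _ NP]; exists N => // n /NP [rho rhoT []]; exists rho.
have [cp fp] := sup_functional_pressure fE pM
  (@pressure_seq_near_ge_moment R d A s beta K C b0 K0 AK C0 AC bA mu mu_prod) optf.
have [_ gp] := sup_functional_pressure gE pM
  (@pressure_seq_near_ge_mean R d A s beta K C b0 K0 AK C0 AC bA mu mu_prod) optg.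
by split => //; rewrite fp gp.
Qed.
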